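(* Fix $\kappa\in(0,1]$ and let $\mathcal{Q}_\kappa$ be the set of probability distributions $Q$ on $\mathbb{N}$ with $Q(\{1,2,\dots\})\ge\kappa$. Then there exist positive constants $C$ and $C'$ depending only on $\kappa$ such that $$\sup_{Q\in\mathcal{Q}_\kappa}P_{Q}\left(\tau_1>t\right)\le Ce^{-C't^{1/2}}\quad\text{for all } t\ge 0,$$ where $P_Q$ is the law of the $Q$-TBRW started from a single edge $\{o,x\}$ rooted at $o$ with the walker at $x$, and $\tau_1$ is its first renewal time.
   Context: $\mathbb{N}$ contains $0$. Tree Builder Random Walk (TBRW): a discrete-time process $\{(T_n,X_n)\}_{n\ge0}$, where $T_n$ is a tree rooted at a fixed vertex $o$ and $X_n$ is a vertex of $T_n$ (the walker's position). It is driven by a sequence $\xi=\{\xi_n\}_n$ of $\mathbb{N}$-valued random variables (the leaf process). Given $(T_{n-1},X_{n-1})$: first, $T_n$ is obtained from $T_{n-1}$ by attaching $\xi_n$ new leaves to $X_{n-1}$ (nothing changes if $\xi_n=0$); then $X_n$ is chosen uniformly among the neighbors of $X_{n-1}$ in $T_n$. If $\{\xi_n\}$ is i.i.d. with law $Q$ (with $\xi_n$ independent of the past of the process up to time $n-1$), the process is called a $Q$-TBRW. $P_Q$ is its law when the initial state is $(\{o,x\},x)$, i.e. $T_0$ is a single edge with root $o$ and $X_0=x\ne o$. $\mathrm{dist}$ is graph distance and $\deg(X_n)$ is the degree of $X_n$ in $T_n$. The first renewal time is $$\tau_1=\inf\{n>0:\ \deg(X_n)=1,\ \mathrm{dist}(X_s,o)<\mathrm{dist}(X_n,o)\le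 \mathrm{dist}(X_t,o)\ \ \forall s<n,\ \forall t>n\},$$ with $\inf\emptyset=\infty$. *)

(* Defs.v *)
(* MathComp / MathComp-Analysis *)
From HB Require Import structures.
From mathcomp Require Import all_boot all_order all_algebra.
From mathcomp Require Import all_classical all_reals all_analysis.

Set Implicit Arguments.
Unset Strict Implicit.
Unset Printing Implicit Defensive.
Import Order.TTheory GRing.Theory Num.Theory.

Local Open Scope classical_set_scope.
Local Open Scope ring_scope.

(* A finite tree with k edges is given by its list of edges; its vertices are
   0, ..., k, numbered by order of birth, and the root o is 0. Only lists grown
   from [single_edge] by [attach] occur below, and these are always trees. *)
Definition tree := seq (nat * nat).

Definition tree_root : nat := 0%N.

Definition vertices (T : tree) : seq nat := iota 0 (size T).+1.

Definition adj (T : tree) (u v : nat) : bool := ((u, v) \in T) || ((v, u) \in T).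

Definition neighbors (T : tree) (v : nat) : seq nat :=
  [seq u <- vertices T | adj T v u].

Definition deg (T : tree) (v : nat) : nat := size (neighbors T v).

Fixpoint walk (T : tree) (n : nat) (u v : nat) : bool :=
  if n is m.+1 then has (fun w => walk T m w v) (neighbors T u) else u == v.

(* [find] returns the least n for which there is a walk of length n from u
   to v; in a graph on k + 1 vertices a shortest walk has length at most k. *)
Definition dist (T : tree) (u v : nat) : nat :=
  find (fun n => walk T n u v) (iota 0 (size T).+1).

Definition single_edge : tree := [:: (tree_root, 1%N)].

Definition attach (T : tree) (v k : nat) : tree :=
  T ++ [seq (v, i) | i <- iota (size T).+1 k].

Section TBRW.
Context {d : measure_display} {Omega : measurableType d} {R : realType}.

Definition past (T : nat -> Omega -> tree) (X : nat -> Omega -> nat)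
    (n : nat) (w : Omega) : seq (tree * nat) :=
  [seq (T i w, X i w) | i <- iota 0 n.+1].

(* The Q-TBRW with leaf process xi_1, xi_2, ... (xi_0 plays no role), started
   from a single edge with the walker at the non-root endpoint.
   - Since xi_1, ..., xi_n are functions of T_0, ..., T_n, [tbrw_indep] contains
     the mutual independence of the leaf process.
   - [tbrw_move] is the conditional law of X_(n+1) given the past up to time n
     and T_(n+1), written out on the atoms of this discrete conditioning; v is
     determined by h. *)
Record is_QTBRW (P : probability Omega R) (Q : probability nat R)
    (xi : nat -> {RV P >-> nat}) (T : nat -> Omega -> tree)
    (X : nat -> {RV P >-> nat}) : Prop := {
  tbrw_T0 : forall w, T 0%N w = single_edge ;
  tbrw_X0 : forall w, X 0%N w = 1%N ;
  tbrw_grow : forall n w, T n.+1 w = attach (T n w) (X n w) (xi n.+1 w) ;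
  tbrw_law : forall n (B : set nat), distribution P (xi n.+1) B = Q B ;
  tbrw_indep : forall n (A : set (seq (tree * nat))) (B : set nat),
    (P ((past T (fun i => X i) n @^-1` A) `&` (xi n.+1 @^-1` B))
     = P (past T (fun i => X i) n @^-1` A) * P (xi n.+1 @^-1` B))%E ;
  tbrw_move : forall n (h : seq (tree * nat)) (T' : tree) (v y : nat),
    let E := [set w | [/\ past T (fun i => X i) n w = h, X n w = v
                        & T n.+1 w = T']] in
    (P (E `&` [set w | X n.+1 w = y])
     = P E * ((y \in neighbors T' v)%:R / (deg T' v)%:R)%:E)%E
}.

Definition is_renewal (T : nat -> Omega -> tree) (X : nat -> Omega -> nat)
    (w : Omega) (n : nat) : Prop :=
  let D k := dist (T k w) (X k w) tree_root in
  [/\ (0 < n)%N, deg (T n w) (X n w) = 1%N,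
      (forall s, (s < n)%N -> (D s < D n)%N)
    & (forall t, (n < t)%N -> (D n <= D t)%N)].

(* [ereal_inf set0 = +oo] *)
Definition tau1 (T : nat -> Omega -> tree) (X : nat -> Omega -> nat)
    (w : Omega) : \bar R :=
  ereal_inf [set (n%:R : R)%:E | n in is_renewal T X w].

End TBRW.

Definition leaf_laws {R : realType} (kappa : R) : set (probability nat R) :=
  [set Q | (kappa%:E <= Q [set k | (1 <= k)%N])%E].

(* The values of P_Q(tau_1 > t) over all realizations of the Q-TBRW on a
   probability space: they all coincide, since Q determines the law of the
   process. *)
Definition renewal_tail {R : realType} (Q : probability nat R) (t : R) :
    set (\bar R) :=
  [set p | exists (d : measure_display) (Omega : measurableType d)
      (P : probability Omega R) (xi : nat -> {RV P >-> nat})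
      (T : nat -> Omega -> tree) (X : nat -> {RV P >-> nat}),
    is_QTBRW Q xi T X /\
    p = P [set w | (t%:E < tau1 T (fun i => X i) w)%E]].

(* Main.v *)
(* At any visit the walk moves to the parent and to a given child with the same
   probability, so the exits of a vertex to its parent and the entries into one of its
   children run a fair race. If a vertex is left k times, each of three children is
   entered k times with probability close to 1/2 once k is large, and the vertices that
   are entered k times form a supercritical branching process. Hence, from any
   configuration, the walk never goes below its present level with probability at least
   some constant that depends on kappa only; the branching process enters through a
   superharmonic function, the [value] of an exploration [record].
   Consequently the walk goes j levels down with probability exponentially small in j,
   and the number of visits to a level has a geometric tail. The second fact shows that
   the walk reaches level m = sqrt t by time t up to probability exp (- c sqrt t). Every
   new maximum of the level is an attempt at a renewal, which fails when it is undercut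
   later; the first fact gives an exponential moment of the maximum reached by a failing
   attempt, so all attempts up to level m fail with probability exp (- c m). *)
Require Import Defs.
From HB Require Import structures.
From mathcomp Require Import all_boot all_order all_algebra.
From mathcomp Require Import all_classical all_reals all_analysis.
From mathcomp Require Import zify ring lra.
Import Order.TTheory GRing.Theory Num.Theory.
Set Implicit Arguments.
Unset Strict Implicit.
Unset Printing Implicit Defensive.
Local Open Scope nat_scope.

(** The law [Q] may have arbitrarily heavy tails, so degrees are unbounded and no given step has a
    probability bounded below, except in comparison with another neighbor of the same vertex. All
    estimates therefore compare the parent with children, the remaining children being neutral, and
    [Q] is controlled only through its mass at 0; this makes the constants uniform. Waiting for a
    child takes about [1 / kappa] visits, and one visit shifts a race of length [k] by a small [d]
    only, so a large [k] makes the waiting negligible. With 5/4 winners on average, the extinction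
    bound [1 - g] requires [3 * g ^+ 2 - 5 / 4 * g <= - g], and [g = 1 / 12] is the largest such
    value. A record is not a function of the state: it is chosen along the way, and the bound holds
    for every record consistent with the position. Hence neither stopping times nor a coupling with
    a branching process occur; the estimates are inductions on a finite horizon, and infinite time
    enters only in the final passage to [tau1]. *)

(** * Trees and depth *)

(* Every edge is listed as (parent, child) and the child born at index i has label i + 1. *)
Definition grown (T : tree) : Prop :=
  0 < size T /\ forall i, i < size T ->
    (nth (0, 0) T i).2 = i.+1 /\ (nth (0, 0) T i).1 <= i.

(** In a grown tree vertex 0 is its own parent, since [0.-1 = 0] and the first edge starts at 0;
    iterating [parent] therefore stops at the root. *)
Definition parent (T : tree) (u : nat) : nat := (nth (0, 0) T u.-1).1.

Definition children (T : tree) (u : nat) : seq nat :=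
  [seq e.2 | e <- T & e.1 == u].

(** Here [n] is fuel; [n = u] is enough because a parent has a smaller label. *)
Fixpoint height (T : tree) (n u : nat) : nat :=
  if n is n'.+1 then (if u == 0 then 0 else (height T n' (parent T u)).+1)
  else 0.

Definition depth (T : tree) (u : nat) : nat := height T u u.

Lemma grown_single : grown single_edge.
Proof. by split=> // -[]. Qed.

Lemma size_attach T v k : size (attach T v k) = size T + k.
Proof. by rewrite /attach size_cat size_map size_iota. Qed.

Lemma grown_attach T v k : grown T -> v <= size T -> grown (attach T v k).
Proof.
move=> [T0 gT] vT; split; first by rewrite size_attach; lia.
move=> i; rewrite size_attach /attach nth_cat => iT.
case: ltnP => [/gT//|Ti].
rewrite (nth_map 0) ?size_iota; last by lia.
by rewrite nth_iota /=; lia.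
Qed.

Lemma grown_gt0 T : grown T -> 0 < size T. Proof. by case. Qed.

Lemma mem_grown T u w : grown T ->
  ((u, w) \in T) = [&& 0 < w, w <= size T & parent T w == u].
Proof.
move=> [T0 gT]; apply/idP/idP.
  move/(nthP (0, 0)) => [i iT /esym E].
  have [g1 g2] := gT _ iT; rewrite -E /= in g1 g2.
  by rewrite g1 /= iT /= /parent /= -E eqxx.
case/and3P=> w0 wT /eqP pu; have wT' : w.-1 < size T by lia.
have [g1 g2] := gT _ wT'.
apply/(nthP (0, 0)); exists w.-1 => //.
rewrite [LHS]surjective_pairing g1 /=; congr (_, _) => //; lia.
Qed.

Lemma mem_children T u w : grown T ->
  (w \in children T u) = [&& 0 < w, w <= size T & parent T w == u].
Proof.
move=> gT; rewrite -mem_grown //; apply/mapP/idP.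
  by move=> [[a b]]; rewrite mem_filter /= => /andP[/eqP -> h] ->.
by move=> h; exists (u, w) => //; rewrite mem_filter /= eqxx.
Qed.

Lemma parent_le T u : grown T -> u <= size T -> parent T u <= u.-1.
Proof.
move=> [T0 gT] uT; rewrite /parent; case: (gT u.-1) => //; lia.
Qed.

Lemma children_attach T v k u :
  children (attach T v k) u =
  children T u ++ (if u == v then iota (size T).+1 k else [::]).
Proof.
rewrite /children /attach filter_cat map_cat; congr (_ ++ _).
rewrite filter_map -map_comp /=; case: (altP (u =P v)) => [->|uv].
  rewrite (@eq_filter _ _ predT) ?filter_predT ?map_id //.
  by move=> i /=; rewrite eqxx.
rewrite (@eq_filter _ _ pred0) ?filter_pred0 // => i /=.
by rewrite eq_sym (negbTE uv).
Qed.

Lemma parent_attach T v k u : u <= size T -> 0 < size T ->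
  parent (attach T v k) u = parent T u.
Proof.
by move=> uT T0; rewrite /parent /attach nth_cat ifT //; lia.
Qed.

Lemma height_stable T n u : grown T -> u <= size T -> u <= n ->
  height T n u = depth T u.
Proof.
move=> gT; elim/ltn_ind: u n => -[_|u IH] [|n] //= uT un.
have := parent_le gT uT => /= pu.
rewrite /depth /=; congr S.
by rewrite !IH //; lia.
Qed.

Lemma depth0 T : depth T 0 = 0. Proof. by []. Qed.

Lemma depthS T u : grown T -> 0 < u <= size T ->
  depth T u = (depth T (parent T u)).+1.
Proof.
move=> gT; case: u => // u /= uT; rewrite {1}/depth /=; congr S.
have := parent_le gT uT => /= pu.
by rewrite height_stable //; lia.
Qed.

Lemma depth_attach T v k u : grown T -> v <= size T -> u <= size T ->
  depth (attach T v k) u = depth T u.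
Proof.
move=> gT vT; have gT' := grown_attach k gT vT.
elim/ltn_ind: u => -[//|u IH] uT.
have := parent_le gT uT => /= pu.
rewrite [RHS]depthS // [LHS]depthS //; last by rewrite size_attach; lia.
by rewrite parent_attach ?(grown_gt0 gT) // IH //; lia.
Qed.

Lemma depth_le T u : grown T -> u <= size T -> depth T u <= u.
Proof.
move=> gT; elim/ltn_ind: u => -[//|u IH] uT.
have := parent_le gT uT => /= pu.
by rewrite depthS //; have := IH (parent T u.+1); lia.
Qed.

Lemma mem_vertices T u : (u \in vertices T) = (u <= size T).
Proof. by rewrite /vertices mem_iota. Qed.

Lemma children_uniq T u : grown T -> uniq (children T u).
Proof.
move=> [T0 gT]; have -> : children T u = [seq e.2 | e <- T & e.1 == u] by [].
apply: (@subseq_uniq _ _ [seq e.2 | e <- T]).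
  by apply: map_subseq; apply: filter_subseq.
suff -> : [seq e.2 | e <- T] = iota 1 (size T) by apply: iota_uniq.
apply: (@eq_from_nth _ 0); first by rewrite size_map size_iota.
move=> i; rewrite size_map => iT; rewrite (nth_map (0, 0)) // nth_iota //.
by case: (gT _ iT).
Qed.

Lemma perm_neighbors T u : grown T -> u <= size T ->
  perm_eq (neighbors T u)
    ((if u == 0 then [::] else [:: parent T u]) ++ children T u).
Proof.
move=> gT uT; apply: uniq_perm.
- by rewrite filter_uniq ?iota_uniq.
- rewrite cat_uniq children_uniq // andbT; case: ifP => u0 /=; first by apply/hasPn.
  apply/hasPn => w; rewrite mem_children //= inE.
  move=> /and3P[w0 wT /eqP pw]; apply/eqP => E.
  have := parent_le gT wT; have := parent_le gT uT; lia.
- move=> w; rewrite mem_filter mem_vertices /adj !mem_grown // mem_cat mem_children //.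
  have := parent_le gT uT.
  case: (altP (u =P 0)) => [->|u0] /= pu.
    by rewrite andbC; case: (leqP w (size T)) => //=; rewrite ?andbF ?andbT ?orbF //= => _; lia.
  rewrite uT (lt0n u) u0 /= inE; case: (leqP w (size T)) => wT /=; rewrite ?andbT ?andbF ?orbF //.
    by rewrite orbC eq_sym.
  by apply/esym/eqP => E; lia.
Qed.

Lemma deg_children T u : grown T -> u <= size T ->
  deg T u = (u != 0) + size (children T u).
Proof.
move=> gT uT; rewrite /deg (perm_size (perm_neighbors gT uT)) size_cat.
by case: (u == 0).
Qed.

Lemma mem_neighbors T u w : grown T -> u <= size T ->
  w \in neighbors T u -> (0 < u /\ w = parent T u) \/ w \in children T u.
Proof.
move=> gT uT; rewrite (perm_mem (perm_neighbors gT uT)) mem_cat.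
by case/orP; [case: (altP (u =P 0)) => //= u0; rewrite inE => /eqP ->; left; split=> //; lia|right].
Qed.

Lemma neighbors_le T u w : w \in neighbors T u -> w <= size T.
Proof. by rewrite mem_filter mem_vertices => /andP[]. Qed.

Lemma depth_neighbor T u w : grown T -> u <= size T ->
  w \in neighbors T u -> depth T u = (depth T w).+1 \/ depth T w = (depth T u).+1.
Proof.
move=> gT uT /(mem_neighbors gT uT)[[u0 ->]|].
  by left; rewrite depthS // u0.
by rewrite mem_children // => /and3P[w0 wT /eqP <-]; right; rewrite depthS // w0.
Qed.

Lemma walk_depth T n u : grown T -> u <= size T -> walk T n u 0 -> depth T u <= n.
Proof.
move=> gT; elim: n u => [|n IH] u uT /=; first by move/eqP ->.
case/hasP => w wu /(IH _ (neighbors_le wu)).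
by case: (depth_neighbor gT uT wu) => ->; lia.
Qed.

Lemma depth_walk T u : grown T -> u <= size T -> walk T (depth T u) u 0.
Proof.
move=> gT; elim/ltn_ind: u => -[//|u IH] uT; rewrite depthS //=.
have := parent_le gT uT => /= pu.
apply/hasP; exists (parent T u.+1); last by apply: IH; lia.
by rewrite (perm_mem (perm_neighbors gT uT)) mem_cat inE eqxx.
Qed.

(** Every edge changes the depth by one, so no walk to the root is shorter than the depth, and
    following parents attains it. *)
Lemma dist_depth T u : grown T -> u <= size T -> dist T u tree_root = depth T u.
Proof.
move=> gT uT; have dT := leq_trans (depth_le gT uT) uT.
rewrite /dist /tree_root; set p := (fun n => _).
have hasp : has p (iota 0 (size T).+1).
  by apply/hasP; exists (depth T u); rewrite ?mem_iota //=; apply: depth_walk.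
apply/eqP; rewrite eqn_leq; apply/andP; split.
  rewrite leqNgt; apply/negP => /(before_find 0).
  by rewrite nth_iota ?add0n // /p depth_walk.
have := nth_find 0 hasp; rewrite has_find size_iota in hasp.
by rewrite nth_iota // add0n => /walk_depth; apply.
Qed.

(** * Ancestors and the region strictly below a vertex *)

Definition desc (T : tree) (w X : nat) : Prop := exists j, iter j (parent T) X = w.

Definition below (T : tree) (u X : nat) : Prop :=
  exists2 w, w \in children T u & desc T w X.

Lemma desc_refl T w : desc T w w. Proof. by exists 0. Qed.

Lemma parent_depth T u : grown T -> u <= size T -> depth T (parent T u) = (depth T u).-1.
Proof.
move=> gT; case: u => [_|u uT]; last by rewrite [in RHS]depthS.
by have := parent_le (u := 0) gT isT; rewrite leqn0 => /eqP ->.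
Qed.

Lemma iter_parent_le T j u : grown T -> u <= size T -> iter j (parent T) u <= size T.
Proof.
by move=> gT uT; elim: j => //= j IH; apply: leq_trans (parent_le gT IH) _; lia.
Qed.

Lemma desc_depth T w X : grown T -> X <= size T -> desc T w X -> depth T w <= depth T X.
Proof.
move=> gT XT [j <-]; elim: j => //= j IH.
by rewrite parent_depth ?iter_parent_le //; lia.
Qed.

Lemma iter_parent_attach T v k j u : grown T -> u <= size T ->
  iter j (parent (attach T v k)) u = iter j (parent T) u.
Proof.
move=> gT uT; elim: j => //= j ->.
by rewrite parent_attach ?iter_parent_le ?(grown_gt0 gT).
Qed.

Lemma desc_attach T v k w X : grown T -> X <= size T ->
  desc T w X -> desc (attach T v k) w X.
Proof. by move=> gT XT [j jw]; exists j; rewrite iter_parent_attach. Qed.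

Lemma mem_children_attach T v k u w : w \in children T u -> w \in children (attach T v k) u.
Proof. by rewrite children_attach mem_cat => ->. Qed.

Lemma below_attach T v k u X : grown T -> X <= size T ->
  below T u X -> below (attach T v k) u X.
Proof.
by move=> gT XT [w wu wX]; exists w; [apply: mem_children_attach|apply: desc_attach].
Qed.

Lemma below_child T u w : w \in children T u -> below T u w.
Proof. by move=> wu; exists w => //; apply: desc_refl. Qed.

Lemma below_depth T u X : grown T -> X <= size T -> below T u X -> depth T u < depth T X.
Proof.
move=> gT XT [w]; rewrite mem_children // => /and3P[w0 wT /eqP <-] /(desc_depth gT XT).
by rewrite [depth T w]depthS // w0.
Qed.

Lemma below_neighbor T u X y : grown T -> X <= size T -> below T u X ->
  y \in neighbors T X -> y = u \/ below T u y.
Proof.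
move=> gT XT [w wu [j jX]] /(mem_neighbors gT XT)[[X0 ->]|yX].
  case: j jX => [/= E|j]; last by rewrite iterSr => jX; right; exists w => //; exists j.
  by left; move: wu; rewrite mem_children // -E => /and3P[_ _ /eqP].
right; exists w => //; exists j.+1; rewrite iterSr.
by move: yX; rewrite mem_children // => /and3P[_ _ /eqP ->].
Qed.

Lemma parent_child T u w : grown T -> w \in children T u -> parent T w = u.
Proof. by move=> gT; rewrite mem_children // => /and3P[_ _ /eqP]. Qed.

Lemma child_bounds T u w : grown T -> w \in children T u -> 0 < w <= size T.
Proof. by move=> gT; rewrite mem_children // => /and3P[-> ->]. Qed.

Local Open Scope classical_set_scope.
Local Open Scope ring_scope.

(** * The fair race between the parent and the children *)

Section Race.
Context {R : realType}.

(** Probability that fair coin tosses produce [a] moves of the child before [m] moves of the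
    parent. *)
Fixpoint race (m : nat) : nat -> R := fix race_m a :=
  match a, m with
  | 0, _ => 1%R
  | _.+1, 0 => 0%R
  | a'.+1, m'.+1 => ((race m' a + race_m a') / 2)%R
  end%N.

Lemma race0r m : race m 0 = 1. Proof. by case: m. Qed.
Lemma race0l a : race 0 a.+1 = 0. Proof. by []. Qed.
Lemma raceSS m a : race m.+1 a.+1 = (race m a.+1 + race m.+1 a) / 2.
Proof. by []. Qed.
Arguments race : simpl never.

Lemma race_bounds m a : 0 <= race m a <= 1.
Proof.
elim: m a => [|m IHm]; elim=> [|a IHa]; rewrite ?race0r ?race0l ?lexx ?ler01 //.
by rewrite raceSS; have := IHm a.+1; lra.
Qed.

Lemma race_sym m a : (0 < m + a)%N -> race m a + race a m = 1.
Proof.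
elim: m a => [|m IHm]; elim=> [|a IHa] //; rewrite ?race0r ?race0l ?addr0 ?add0r // => _.
rewrite !raceSS.
have h1 : race m a.+1 + race a.+1 m = 1 by apply: IHm; rewrite addnS.
have h2 : race m.+1 a + race a m.+1 = 1 by apply: IHa.
lra.
Qed.

Lemma race_diag k : (0 < k)%N -> race k k = 1 / 2.
Proof. by move=> k0; have := @race_sym k k; rewrite addn_gt0 k0 => /(_ isT); lra. Qed.

(** The difference is a negative binomial mass: the child completes its [a + 1] moves when the
    parent has made exactly [m]. *)
Lemma race_diff m a :
  race m.+1 a.+1 - race m a.+1 = 'C(m + a, m)%:R / 2 ^+ (m + a).+1.
Proof.
elim: m a => [|m IHm] a.
  rewrite bin0 add0n race0l subr0; elim: a => [|a IHa].
    by rewrite raceSS race0l race0r expr1 add0r.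
  by rewrite raceSS race0l IHa [in RHS]exprS invfM; lra.
elim: a => [|a IHa].
  have := IHm 0%N; rewrite !addn0 !binn !(raceSS _ 0) !race0r.
  by rewrite [2 ^+ m.+2]exprS invfM; lra.
have e1 := raceSS m.+1 a.+1; have e2 := raceSS m a.+1.
have := IHm a.+1; move: IHa.
rewrite !addnS !addSn [in X in _ -> _ -> X]binS natrD => h1 h2.
by rewrite [2 ^+ (m + a).+3]exprS invfM; lra.
Qed.

(** The square is a single term of the Vandermonde sum for the central coefficient. *)
Lemma bin_sqr_le n m : ('C(n, m) * 'C(n, m) <= 'C(n + n, n))%N.
Proof.
case: (leqP m n) => mn; last by rewrite bin_small.
rewrite -(binomial.Vandermonde n n n) -{2}(bin_sub mn).
by rewrite (bigD1 (Ordinal (mn : m < n.+1)%N)) //= leq_addr.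
Qed.

(** Consecutive left sides have ratio [(2n+1)(2n+3) / (2n+2)^2], which is below 1. *)
Lemma central_bin_sqr n :
  (('C(n + n, n)%:R / 4 ^+ n) ^+ 2 * (n + n).+1%:R <= 1 :> R).
Proof.
elim: n => [|n IH]; first by rewrite bin0 expr0 divr1 expr1n mul1r.
set b := _ / _ in IH.
have -> : 'C(n.+1 + n.+1, n.+1)%:R / 4 ^+ n.+1 = b * ((2 * n%:R + 1) / (2 * n%:R + 2)) :> R.
  have /(congr1 (fun x => x%:R : R)) :
      (n.+1 * (n.+1 * 'C(n.+1 + n.+1, n.+1)) = (n + n).+2 * ((n + n).+1 * 'C(n + n, n)))%N.
    rewrite addSn addnS -mul_bin_diag mulnCA; congr (_ * _)%N.
    by have := mul_bin_down (n + n).+1 n; rewrite /= subSn ?leq_addr // addnK => ->.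
  rewrite !natrM -[n.+1%:R]natr1 -[(n + n).+2%:R]natr1 -[(n + n).+1%:R]natr1 natrD => E.
  have n0 : 0 <= n%:R :> R by rewrite ler0n.
  have -> : 'C(n.+1 + n.+1, n.+1)%:R =
     (n%:R + n%:R + 1 + 1) * (n%:R + n%:R + 1) / ((n%:R + 1) * (n%:R + 1)) * 'C(n + n, n)%:R :> R.
    apply: (@mulfI _ ((n%:R + 1) * (n%:R + 1))); first by rewrite mulf_neq0 //; lra.
    by rewrite -mulrA E; field; lra.
  rewrite /b exprS invfM.
  by field; rewrite expf_neq0 //=; lra.
apply: le_trans IH.
rewrite exprMn -mulrA ler_wpM2l ?sqr_ge0 //.
rewrite -[(n + n).+1%:R]natr1 -[(n.+1 + n.+1).+1%:R]natr1 !natrD -!natr1.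
have n0 : 0 <= n%:R :> R by rewrite ler0n.
rewrite expr_div_n mulrAC ler_pdivrMr; last by rewrite exprn_gt0 //; lra.
by nra.
Qed.

Lemma race_incr m a : race m a <= race m.+1 a.
Proof.
case: a => [|a]; first by rewrite !race0r.
by rewrite -subr_ge0 race_diff divr_ge0 ?ler0n ?exprn_ge0.
Qed.

(** The increments are at most of order [k^(-1/4)]; this crude rate suffices, and comparing fourth
    powers avoids square roots. The condition on [d * k] makes [setup_bound] trivial when no exits
    are left. *)
Lemma race_diff_small (d : R) : 0 < d ->
  exists k, [/\ (0 < k)%N, 1 / 2 <= d * k%:R &
    forall m, race m.+1 k - race m k <= d].
Proof.
move=> d0.
have [k hk1 hk2] : exists2 k : nat, 1 / 2 <= d * k%:R & 1 <= 16 * d ^+ 4 * k%:R.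
  have d4 : 0 < 16 * d ^+ 4 by rewrite mulr_gt0 ?exprn_gt0.
  exists (Num.bound (1 / (2 * d) + 1 / (16 * d ^+ 4))).
    apply: (@le_trans _ _ (d * (1 / (2 * d) + 1 / (16 * d ^+ 4)))).
      have : 0 <= d * (1 / (16 * d ^+ 4)) by rewrite mulr_ge0 ?divr_ge0 // ltW.
      have -> : d * (1 / (2 * d) + 1 / (16 * d ^+ 4)) = 1 / 2 + d * (1 / (16 * d ^+ 4)).
        by rewrite mulrDr; congr (_ + _); field; rewrite gt_eqF.
      lra.
    rewrite ler_pM2l // ltW //; apply: le_lt_trans (archi_boundP _); first exact: lexx.
    by rewrite addr_ge0 ?divr_ge0 // ?mulr_ge0 // ltW.
  rewrite mulrC -ler_pdivrMr //; apply: (@le_trans _ _ (1 / (2 * d) + 1 / (16 * d ^+ 4))).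
    by rewrite lerDr divr_ge0 // mulr_ge0 // ltW.
  rewrite ltW //; apply: le_lt_trans (archi_boundP _); first exact: lexx.
  by rewrite addr_ge0 ?divr_ge0 // ?mulr_ge0 // ltW.
exists k; case: k hk1 hk2 => [|k] hk1 hk2; first by rewrite mulr0 in hk1; lra.
split=> // m; rewrite race_diff.
set n := (m + k)%N; set e := _ / _.
have e0 : 0 <= e by rewrite divr_ge0 ?ler0n ?exprn_ge0.
rewrite -(@ler_pXn2r _ 4) ?nnegrE // ?(ltW d0) //.
have n0 : 0 < n.+1%:R :> R by rewrite ltr0n.
apply: (@le_trans _ _ (1 / (16 * k.+1%:R))); last first.
  by rewrite ler_pdivrMr ?mulr_gt0 ?ltr0n // mulrCA mulrA.
apply: (@le_trans _ _ (1 / (16 * n.+1%:R))); last first.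
  by rewrite !div1r lef_pV2 ?posrE ?mulr_gt0 ?ltr0n // ler_pM2l // ler_nat ltnS leq_addl.
rewrite ler_pdivlMr ?mulr_gt0 //.
have e2 : 4 * e ^+ 2 <= 'C(n + n, n)%:R / 4 ^+ n.
  have -> : 4 * e ^+ 2 = ('C(n, m) * 'C(n, m))%:R / 4 ^+ n.
    have -> : 4 ^+ n = 2 ^+ n * 2 ^+ n :> R by rewrite -exprMn -natrM.
    by rewrite /e -/n natrM [2 ^+ n.+1]exprS; field; rewrite expf_neq0 ?pnatr_eq0.
  by rewrite ler_pM2r ?invr_gt0 ?exprn_gt0 // ler_nat bin_sqr_le.
apply: le_trans (central_bin_sqr n).
have -> : e ^+ 4 * (16 * n.+1%:R) = (4 * e ^+ 2) ^+ 2 * n.+1%:R by ring.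
apply: ler_pM => //.
- by rewrite sqr_ge0.
- by have := sqr_ge0 e => e20; rewrite ler_pXn2r // nnegrE; lra.
- by rewrite ler_nat ltnS leq_addr.
Qed.

Lemma race_near_half (d : R) k m : (forall i, race i.+1 k - race i k <= d) ->
  (0 < k)%N -> (m <= k)%N -> 1 / 2 - d * (k - m)%:R <= race m k.
Proof.
move=> hd k0 mk; rewrite -{1}(race_diag k0) -{1}(subnKC mk).
elim: (k - m)%N => [|i IH]; first by rewrite addn0 mulr0 subr0.
have := hd (m + i)%N; rewrite addnS -natr1; lra.
Qed.

(* Probability bound for losing all of three descendants, when a fresh vertex still
   lacks [j] children and has [m] exits left; every visit is charged as an exit. *)
Fixpoint setup (ka g : R) (k j m : nat) : R :=
  match m, j with
  | 0, _ => 1%R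
  | m'.+1, 0 => Num.min 1 (1 - 3 * g * race m k + 3 * g ^+ 2)
  | m'.+1, j'.+1 => (1 - ka) * setup ka g k j m' + ka * setup ka g k j' m'
  end.

Section Setup.
Variables (ka g : R) (k : nat).
Hypotheses (ka0 : 0 < ka) (ka1 : ka <= 1) (g0 : 0 <= g) (g1 : g <= 1 / 3).
Hypothesis k0 : (0 < k)%N.
Local Notation S := (setup ka g k).

Lemma setupSS j m : S j.+1 m.+1 = (1 - ka) * S j.+1 m + ka * S j m.
Proof. by []. Qed.

Lemma setup_bounds j m : 0 <= S j m <= 1.
Proof.
move: (ka0) (ka1) (g0) (g1) => ka0' ka1' g0' g1'.
elim: m j => [|m IH] [|j]; rewrite ?lexx ?ler01 //.
  rewrite /= le_min ler01 ge_min lexx !andbT /=.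
  have /andP[r0 r1] := race_bounds m.+1 k.
  have : g * race m.+1 k <= 1 / 3 * 1 by apply: ler_pM.
  have := sqr_ge0 g; lra.
by rewrite setupSS; have /andP[? ?] := IH j.+1; have /andP[? ?] := IH j; apply/andP; split; nra.
Qed.

Lemma setup0 m : S 0 m = Num.min 1 (1 - 3 * g * race m k + 3 * g ^+ 2).
Proof.
case: m => [|m] //; rewrite /=; apply/esym/min_idPl.
by case: k k0 => // k' _; rewrite race0l; nra.
Qed.

Lemma setup_decr j m : S j m.+1 <= S j m.
Proof.
move: (ka0) (ka1) (g0) (g1) => ka0' ka1' g0' g1'.
elim: m j => [|m IH] j; first by case/andP: (setup_bounds j 1).
case: j => [|j].
  rewrite !setup0 le_min !ge_min lexx /=; apply/orP; right.
  by have := race_incr m.+1 k; nra.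
by rewrite !setupSS; have := IH j.+1; have := IH j; rewrite setupSS; nra.
Qed.

Lemma setup_incr j m : S j m <= S j.+1 m.
Proof.
move: (ka0) (ka1) (g0) (g1) => ka0' ka1' g0' g1'.
elim: m j => [|m IH] j; first by [].
rewrite setupSS.
by have := IH j; have := setup_decr j m; nra.
Qed.

(** Each visit charged as an exit costs at most [d] in the chance of winning a race, and finding [j]
    children takes [j / ka] visits on average. *)
Lemma setup_bound (d : R) j m : 0 <= d -> 1 / 2 <= d * k%:R ->
  (forall i, race i.+1 k - race i k <= d) -> (m <= k)%N ->
  S j m <= 1 + 3 * g ^+ 2 - 3 * g * (1 / 2 - d * (k - m)%:R - d * j%:R / ka).
Proof.
move: (ka0) (ka1) (g0) (g1) => ka0' ka1' g0' g1'.
move=> d0 dk hd.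
elim: m j => [|m IH] j mk.
  rewrite subn0; have : 0 <= d * j%:R / ka by rewrite !mulr_ge0 ?invr_ge0 ?ler0n // ltW.
  by have -> : setup ka g k j 0 = 1 by []; nra.
have mk' := ltnW mk.
have e : (k - m)%:R = (k - m.+1)%:R + 1 :> R by rewrite natr1; congr _%:R; lia.
case: j => [|j].
  rewrite setup0 ge_min mulr0 mul0r subr0; apply/orP; right.
  by have := race_near_half hd k0 mk; nra.
rewrite setupSS.
apply: (@le_trans _ _ (
  (1 - ka) * (1 + 3 * g ^+ 2 - 3 * g * (1 / 2 - d * (k - m)%:R - d * j.+1%:R / ka)) +
  ka * (1 + 3 * g ^+ 2 - 3 * g * (1 / 2 - d * (k - m)%:R - d * j%:R / ka)))).
  by apply: lerD; rewrite ler_wpM2l ?IH //; lra.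
rewrite e -natr1.
by rewrite le_eqVlt; apply/orP; left; apply/eqP; field; rewrite gt_eqF.
Qed.

End Setup.

(* With [d = ka / 36] each of the three children wins its race with probability at least
   5/12, and the mean number 5/4 of winners exceeds 1. *)
Lemma setup_supercritical (ka : R) : 0 < ka <= 1 ->
  exists2 k, (0 < k)%N & setup ka (1 / 12) k 3 k <= 1 - 1 / 12.
Proof.
move=> ka01; have d0 : 0 < ka / 36 by lra.
have [k [k0 dk hd]] := race_diff_small d0; exists k => //.
case/andP: ka01 => ka0 ka1.
have g0 : 0 <= 1 / 12 :> R by lra.
have g1 : 1 / 12 <= 1 / 3 :> R by lra.
have := setup_bound ka0 ka1 g0 g1 k0 3 (ltW d0) dk hd (leqnn k).
rewrite subnn mulr0 subr0.
have -> : ka / 36 * 3%:R / ka = 1 / 12 by field; rewrite gt_eqF //; lra.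
lra.
Qed.

End Race.
Arguments race {R} : simpl never.

Definition update {A : Type} (f : nat -> A) (i : nat) (x : A) : nat -> A :=
  fun j => if j == i then x else f j.

Lemma update_same A (f : nat -> A) i x : update f i x i = x.
Proof. by rewrite /update eqxx. Qed.

Lemma update_id A (f : nat -> A) i : update f i (f i) = f.
Proof. by apply/funext => j; rewrite /update; case: eqP => // ->. Qed.

Lemma update_neq A (f : nat -> A) i j x : j != i -> update f i x j = f j.
Proof. by rewrite /update => /negbTE ->. Qed.

Lemma big_ord3 (T : Type) (idx : T) (op : Monoid.law idx) (F : 'I_3 -> T) :
  \big[op/idx]_(i < 3) F i =
  op (op (F (@Ordinal 3 0 isT)) (F (@Ordinal 3 1 isT))) (F (@Ordinal 3 2 isT)).
Proof.
rewrite !big_ord_recr big_ord0 /= Monoid.mul1m.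
by congr (op (op (F _) (F _)) (F _)); apply: val_inj.
Qed.

(** * Three children racing jointly against the parent *)

Section Family.
Context {R : realType}.
Implicit Types (nu : nat -> nat) (psi : nat -> R).

Definition completed nu psi : R := \prod_(i < 3) (if nu i == 0%N then psi i else 1).

Definition step nu i : nat -> nat := update nu i (nu i).-1.

(* [lost n m nu psi] is the mean of the product of [psi i] over those of the three
   competitors that make [nu i] moves before the parent makes [m] moves, the next
   move being uniform among the parent and the competitors still running; [n] is fuel. *)
Fixpoint lost n m nu psi : R :=
  match n, m with
  | n'.+1, m'.+1 =>
    (lost n' m' nu psi + \sum_(i < 3 | (0 < nu i)%N) lost n' m (step nu i) psi)
    / (1 + \sum_(i < 3) ((0 < nu i)%N)%:R)
  | _, _ => completed nu psi
  end.

Definition total nu := (\sum_(i < 3) nu i)%N.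

Definition mean_lost m nu psi := lost (m + total nu) m nu psi.

Lemma total_step nu i : (i < 3)%N -> (0 < nu i)%N -> total nu = (total (step nu i)).+1.
Proof.
rewrite /total !big_ord3 /step /update /=.
by case: i => [|[|[|i]]] //= _ h; lia.
Qed.

Lemma divisor_gt0 nu : 0 < 1 + \sum_(i < 3) ((0 < nu i)%N)%:R :> R.
Proof. by rewrite ltr_pwDl // sumr_ge0. Qed.

Lemma completed_bounds nu psi : (forall i, 0 <= psi i <= 1) -> 0 <= completed nu psi <= 1.
Proof.
move=> h; have h' i : 0 <= (if nu i == 0%N then psi i else 1) <= 1.
  by case: ifP => //; rewrite ler01 lexx.
apply/andP; split; first by apply: prodr_ge0 => i _; case/andP: (h' i).
by apply: Num.Theory.prodr_ile1.
Qed.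

Lemma lost_bounds n m nu psi : (forall i, 0 <= psi i <= 1) -> 0 <= lost n m nu psi <= 1.
Proof.
move=> h; elim: n m nu => [|n IH] [|m] nu; try exact: completed_bounds.
rewrite /= -/lost; apply/andP; split.
  apply: divr_ge0; last exact: ltW (divisor_gt0 nu).
  rewrite addr_ge0 ?sumr_ge0 //; first by case/andP: (IH m nu).
  by move=> i _; case/andP: (IH m.+1 (step nu i)).
rewrite ler_pdivrMr ?divisor_gt0 // mul1r lerD //; first by case/andP: (IH m nu).
rewrite big_mkcond; apply: ler_sum => i _; case: ifP => //= _.
by case/andP: (IH m.+1 (step nu i)).
Qed.

Lemma mean_lost_bounds m nu psi : (forall i, 0 <= psi i <= 1) -> 0 <= mean_lost m nu psi <= 1.
Proof. exact: lost_bounds. Qed.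

Lemma mean_lostS m nu psi :
  mean_lost m.+1 nu psi * (1 + \sum_(i < 3) ((0 < nu i)%N)%:R) =
  mean_lost m nu psi + \sum_(i < 3 | (0 < nu i)%N) mean_lost m.+1 (step nu i) psi.
Proof.
rewrite {1}/mean_lost addSn /= mulrVK; last by rewrite unitfE gt_eqF ?divisor_gt0.
congr (_ + _); apply: eq_bigr => i nui; rewrite /mean_lost; congr (lost _ _ _ _).
by rewrite (total_step (ltn_ord i) nui) addSn addnS.
Qed.

Lemma mean_lost0 nu psi : mean_lost 0 nu psi = completed nu psi.
Proof. by rewrite /mean_lost add0n; case: (total nu). Qed.

Lemma completed_step nu psi i : (i < 3)%N -> (forall i, 0 <= psi i <= 1) ->
  completed (step nu i) psi <= completed nu psi.
Proof.
move=> i3 h; apply: ler_prod => j _; rewrite /step /update.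
case: (altP (nat_of_ord j =P i)) => [->|_].
  have /andP[h0' h1] := h i; case: (nu i) => [|[|n]] /=; rewrite ?h0' ?h1 ?lexx ?ler01 //.
by rewrite lexx andbT; case: ifP => // _; case/andP: (h j).
Qed.

(** Superharmonicity as a sum of increments instead of an average: neighbors outside the race
    contribute zero, so the degree does not appear. A finished competitor also contributes zero, as
    [step] then leaves [nu] unchanged. *)
Lemma mean_lost_drift m nu psi : (forall i, 0 <= psi i <= 1) ->
  (mean_lost m.-1 nu psi - mean_lost m nu psi) +
  \sum_(i < 3) (mean_lost m (step nu i) psi - mean_lost m nu psi) <= 0.
Proof.
move=> h; case: m => [|m] /=.
  rewrite subrr add0r; apply: sumr_le0 => i _.
  by rewrite !mean_lost0 subr_le0 completed_step.
have E := mean_lostS m nu psi.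
rewrite [X in _ + X](_ : _ = \sum_(i < 3 | (0 < nu i)%N) mean_lost m.+1 (step nu i) psi
   - mean_lost m.+1 nu psi * \sum_(i < 3) ((0 < nu i)%N)%:R).
  by rewrite mulrDr mulr1 in E; lra.
rewrite [X in _ = X - _]big_mkcond mulr_sumr -sumrB; apply: eq_bigr => i _.
case: ltnP => [_|nui]; first by rewrite mulr1.
suff -> : step nu i = nu by rewrite subrr mulr0 subr0.
by rewrite /step -[RHS](update_id _ i); congr update; lia.
Qed.

(** Each [psi i] occurs at most once in the products averaged by [lost]. Being affine with
    nonnegative coefficients in it lets a one-step inequality for a child's value pass to the value
    of the parent. *)
Definition affine (f : R -> R) :=
  exists a b, [/\ 0 <= a, 0 <= b & forall t, f t = a + b * t].

Lemma affine_cst a : 0 <= a -> affine (fun=> a).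
Proof. by exists a, 0; split=> // t; rewrite mul0r addr0. Qed.

Lemma affine_add f g : affine f -> affine g -> affine (fun t => f t + g t).
Proof.
move=> [a [b [a0 b0 fE]]] [c [d [c0 d0 gE]]]; exists (a + c), (b + d).
by split; rewrite ?addr_ge0 // => t; rewrite fE gE; ring.
Qed.

Lemma affine_scale c f : 0 <= c -> affine f -> affine (fun t => f t * c).
Proof.
move=> c0 [a [b [a0 b0 fE]]]; exists (a * c), (b * c).
by split; rewrite ?mulr_ge0 // => t; rewrite fE; ring.
Qed.

Lemma affine_sum (I : Type) (r : seq I) (P : pred I) (F : I -> R -> R) :
  (forall i, affine (F i)) -> affine (fun t => \sum_(i <- r | P i) F i t).
Proof.
move=> h; elim: r => [|x r IH].
  by under eq_fun do rewrite big_nil; apply: affine_cst.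
under eq_fun do rewrite big_cons; case: (P x) => //; exact: affine_add.
Qed.

Lemma affine_completed nu psi i : (i < 3)%N -> (forall i, 0 <= psi i <= 1) ->
  affine (fun t => completed nu (update psi i t)).
Proof.
move=> i3 h.
under eq_fun => t do rewrite /completed (bigD1 (Ordinal i3)) //= update_same.
have E t : \prod_(j < 3 | j != Ordinal i3) (if nu j == 0%N then update psi i t j else 1)
         = \prod_(j < 3 | j != Ordinal i3) (if nu j == 0%N then psi j else 1).
  by apply: eq_bigr => j ji; rewrite update_neq.
under eq_fun do rewrite E; apply: affine_scale.
  by apply: prodr_ge0 => j _; case: ifP => // _; case/andP: (h j).
case: (nu i == 0%N); last exact: affine_cst.
by exists 0, 1; split=> // t; rewrite add0r mul1r.
Qed.

Lemma affine_lost n m nu psi i : (i < 3)%N -> (forall i, 0 <= psi i <= 1) ->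
  affine (fun t => lost n m nu (update psi i t)).
Proof.
move=> i3 h; elim: n m nu => [|n IH] [|m] nu; try exact: affine_completed.
pose D := 1 + \sum_(j < 3) ((0 < nu j)%N)%:R : R.
apply: (@affine_scale D^-1 (fun t => lost n m nu (update psi i t) +
  \sum_(j < 3 | (0 < nu j)%N) lost n m.+1 (step nu j) (update psi i t))).
  by rewrite invr_ge0 ltW ?divisor_gt0.
apply: affine_add; first exact: IH.
by apply: affine_sum => j; apply: IH.
Qed.

Lemma affine_mean_lost m nu psi i : (i < 3)%N -> (forall i, 0 <= psi i <= 1) ->
  affine (fun t => mean_lost m nu (update psi i t)).
Proof. exact: affine_lost. Qed.

Lemma mean_lost_le m nu psi i t : (i < 3)%N -> (forall i, 0 <= psi i <= 1) ->
  t <= psi i -> mean_lost m nu (update psi i t) <= mean_lost m nu psi.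
Proof.
move=> i3 h ti; have [a [b [a0 b0 E]]] := affine_mean_lost m nu i3 h.
by rewrite -{2}(update_id psi i) !E lerD2l ler_wpM2l.
Qed.

(** Bonferroni: with [N <= 3] winners, [(1 - g)^N <= 1 - g N + 3 g^2], and each competitor, seen
    alone against the parent, runs a fair race. *)
Lemma lost_union_bound (g : R) n m nu : 0 <= g <= 1 -> n = (m + total nu)%N ->
  lost n m nu (fun=> 1 - g) <=
  1 - g * (\sum_(i < 3) race m (nu i)) + 3 * g ^+ 2.
Proof.
move=> /andP[g0 g1]; elim: n m nu => [|n IH] m nu.
  move=> /esym/eqP; rewrite addn_eq0 => /andP[/eqP -> /eqP].
  rewrite /total !big_ord3 /= => nu0.
  have [n0 n1 n2] : [/\ nu 0%N = 0%N, nu 1%N = 0%N & nu 2%N = 0%N] by split; lia.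
  rewrite /lost /completed !big_ord3 /=.
  by rewrite n0 n1 n2 !race0r /=; nra.
case: m => [|m] E.
  rewrite /lost /completed !big_ord3 /=.
  by case: (nu 0%N) => [|?]; case: (nu 1%N) => [|?]; case: (nu 2%N) => [|?];
    rewrite ?race0r ?race0l /=; nra.
rewrite /= -/lost ler_pdivrMr ?divisor_gt0 //.
have hP := IH m nu; have hD i := IH m.+1 (step nu i).
apply: (@le_trans _ _ ((1 - g * (\sum_(i < 3) race m (nu i)) + 3 * g ^+ 2) +
  \sum_(i < 3 | (0 < nu i)%N)
    (1 - g * (\sum_(j < 3) race m.+1 (step nu i j)) + 3 * g ^+ 2))).
  apply: lerD; first by apply: hP; lia.
  apply: ler_sum => i nui; apply: hD.
  by move: E; rewrite (total_step (ltn_ord i) nui); lia.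
rewrite [X in _ + X <= _]big_mkcond /= !big_ord3 /= /step /update /=.
by case: (nu 0%N) => [|?]; case: (nu 1%N) => [|?]; case: (nu 2%N) => [|?] /=;
  rewrite ?race0r ?raceSS; lra.
Qed.

Lemma mean_lost_setup (ka g : R) k m : 0 <= g -> g <= 1 -> (0 < k)%N ->
  mean_lost m (fun=> k) (fun=> 1 - g) <= setup ka g k 0 m.
Proof.
move=> g0 g1 k0; rewrite setup0 // le_min; apply/andP; split.
  have h : forall i : nat, 0 <= (fun=> 1 - g) i <= 1 by move=> i; lra.
  by case/andP: (mean_lost_bounds m (fun=> k) h).
have g01 : 0 <= g <= 1 by lra.
apply: le_trans (@lost_union_bound g _ m (fun=> k) g01 erefl) _.
by rewrite !big_ord3 /=; lra.
Qed.

End Family.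

(** * The transition kernel *)

Definition valid (s : tree * nat) : Prop := grown s.1 /\ (s.2 <= size s.1)%N.

Lemma valid_attach T v k : valid (T, v) -> valid (attach T v k, v).
Proof.
move=> [gT vT]; split=> /=; first exact: grown_attach.
by rewrite size_attach (leq_trans vT) ?leq_addr.
Qed.

Lemma valid_move T v k y : valid (T, v) -> y \in neighbors (attach T v k) v ->
  valid (attach T v k, y).
Proof. by move=> /(valid_attach k) [gT _] /neighbors_le yT; split. Qed.

Lemma deg_gt0 T v : valid (T, v) -> (0 < deg T v)%N.
Proof.
move=> [gT vT]; rewrite deg_children //; case: eqP => //= v0.
have : 1%N \in children T v.
  rewrite mem_children //= (grown_gt0 gT) v0 /=.
  by have := parent_le gT (grown_gt0 gT); rewrite leqn0.
by case: (children T v).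
Qed.

Section Kernel.
Context {R : realType}.
Implicit Types (f g : tree * nat -> \bar R) (Q : probability nat R).
Local Open Scope ereal_scope.

Lemma integral_prob_cst Q (c : R) : \int[Q]_k c%:E = c%:E.
Proof.
have := integral_cst Q measurableT c%:E; rewrite /= => ->.
by rewrite probability_setT mule1.
Qed.

Definition average f (T : tree) (v : nat) : \bar R :=
  (\sum_(y <- neighbors T v) f (T, y)) * ((deg T v)%:R^-1)%:E.

Definition kernel Q f (s : tree * nat) : \bar R :=
  \int[Q]_k average f (attach s.1 s.2 k) s.2.

Lemma average_ge0 f T v : (forall s, 0 <= f s) -> 0 <= average f T v.
Proof.
by move=> f0; rewrite mule_ge0 ?sume_ge0 // lee_fin invr_ge0 ler0n.
Qed.

Lemma average_le f g T v : (forall y, y \in neighbors T v -> f (T, y) <= g (T, y)) ->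
  average f T v <= average g T v.
Proof.
move=> fg; rewrite lee_wpmul2r ?lee_fin ?invr_ge0 ?ler0n //.
by rewrite big_seq [leRHS]big_seq; apply: lee_sum.
Qed.

Lemma average_cst T v (c : R) : valid (T, v) -> average (fun=> c%:E) T v = c%:E.
Proof.
move=> /deg_gt0 d0; rewrite /average sumEFin -EFinM; congr EFin.
rewrite big_const_seq count_predT iter_addr_0 -/(deg T v) -[(c *+ _)%R]mulr_natr mulfK //.
by rewrite pnatr_eq0 -lt0n.
Qed.

Lemma average_add f g T v : (forall s, 0 <= f s) -> (forall s, 0 <= g s) ->
  average (fun s => f s + g s) T v = average f T v + average g T v.
Proof.
move=> f0 g0; rewrite /average big_split /= ge0_muleDl ?sume_ge0 //.
Qed.

Lemma average_scale f T v (c : R) : (0 <= c)%R -> (forall s, 0 <= f s) ->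
  average (fun s => c%:E * f s) T v = c%:E * average f T v.
Proof.
by move=> c0 f0; rewrite /average -ge0_sume_distrr // muleA.
Qed.

Lemma kernel_ge0 Q f s : (forall s, 0 <= f s) -> 0 <= kernel Q f s.
Proof. by move=> f0; apply: integral_ge0 => k _; apply: average_ge0. Qed.

Lemma kernel_le Q f g T v : (forall s, 0 <= f s) ->
  (forall k y, y \in neighbors (attach T v k) v -> f (attach T v k, y) <= g (attach T v k, y)) ->
  kernel Q f (T, v) <= kernel Q g (T, v).
Proof.
move=> f0 fg; apply: ge0_le_integral => //.
- by move=> k _; apply: average_ge0.
- by move=> k _; apply: average_le => y /fg.
Qed.

Lemma kernel_add Q f g s : (forall s, 0 <= f s) -> (forall s, 0 <= g s) ->
  kernel Q (fun s => f s + g s) s = kernel Q f s + kernel Q g s.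
Proof.
move=> f0 g0; rewrite /kernel; under eq_integral do rewrite average_add //.
by rewrite ge0_integralD // => k _; apply: average_ge0.
Qed.

Lemma kernel_scale Q f s (c : R) : (0 <= c)%R -> (forall s, 0 <= f s) ->
  kernel Q (fun s => c%:E * f s) s = c%:E * kernel Q f s.
Proof.
move=> c0 f0; rewrite /kernel; under eq_integral do rewrite average_scale //.
by rewrite ge0_integralZl_EFin // => k _; apply: average_ge0.
Qed.

Lemma leaf_law_0 Q (ka : R) : leaf_laws ka Q -> Q [set 0%N] <= (1 - ka)%:E.
Proof.
rewrite /leaf_laws /= => h.
have -> : [set 0%N] = ~` [set k | (1 <= k)%N].
  by apply/seteqP; split=> -[|k] //=.
rewrite probability_setC //.
by rewrite EFinB leeB.
Qed.

(** Growth is only split into no leaf and some leaf. As [A1 <= A0], the worst case is mass [1 - ka]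
    at 0, whatever the rest of [Q]. *)
Lemma kernel_two Q (ka A0 A1 : R) f T v : leaf_laws ka Q -> (forall s, 0 <= f s) ->
  (0 <= A1)%R -> (A1 <= A0)%R ->
  average f T v <= A0%:E ->
  (forall k, (0 < k)%N -> average f (attach T v k) v <= A1%:E) ->
  kernel Q f (T, v) <= ((1 - ka) * A0 + ka * A1)%:E.
Proof.
move=> Qka f0 A10 A1A0 h0 h1.
apply: (@le_trans _ _ (\int[Q]_k (A1%:E + (A0 - A1)%:E * (\1_[set 0%N] k)%:E))).
  apply: ge0_le_integral => //.
  - by move=> k _; apply: average_ge0.
  - case=> [|k] _ /=.
      rewrite indicE mem_set // mule1 -EFinD subrKC.
      by rewrite /attach cats0.
    by rewrite indicE memNset // mule0 adde0; apply: h1.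
rewrite ge0_integralD //; last by move=> k _; rewrite mule_ge0 // lee_fin subr_ge0.
rewrite integral_prob_cst ge0_integralZl_EFin //; last by rewrite subr_ge0.
rewrite integral_indic // setIT.
apply: (@le_trans _ _ (A1%:E + (A0 - A1)%:E * (1 - ka)%:E)).
  by rewrite leeD2l // lee_wpmul2l ?lee_fin ?subr_ge0 // leaf_law_0.
by rewrite -EFinM -EFinD lee_fin; lra.
Qed.

Lemma kernel_cst Q s (c : R) : (0 <= c)%R -> valid s -> kernel Q (fun=> c%:E) s = c%:E.
Proof.
case: s => T v c0 vs; rewrite /kernel /=.
under eq_integral => k _ do rewrite (average_cst _ (valid_attach k vs)).
by rewrite integral_prob_cst.
Qed.

Lemma kernel_average_le Q (c : R) f T v : (forall s, 0 <= f s) -> (0 <= c)%R ->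
  (forall k, average f (attach T v k) v <= c%:E) -> kernel Q f (T, v) <= c%:E.
Proof.
move=> f0 c0 h; rewrite -[leRHS](integral_prob_cst Q); apply: ge0_le_integral => //.
by move=> k _; apply: average_ge0.
Qed.

Lemma average_le_cst (c : R) f T v : valid (T, v) ->
  (forall y, y \in neighbors T v -> f (T, y) <= c%:E) -> average f T v <= c%:E.
Proof. by move=> vs h; rewrite -(average_cst c vs); apply: average_le. Qed.

Lemma kernel_le_cst Q (c : R) f T v : valid (T, v) -> (forall s, 0 <= f s) -> (0 <= c)%R ->
  (forall k y, y \in neighbors (attach T v k) v -> f (attach T v k, y) <= c%:E) ->
  kernel Q f (T, v) <= c%:E.
Proof.
move=> vs f0 c0 h; apply: kernel_average_le => // k.
by apply: average_le_cst => [|y]; [exact: valid_attach|exact: h].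
Qed.

(** The bound [M] makes [f] finite on the neighbors, so that [fine] loses nothing and the comparison
    takes place in the reals. *)
Lemma average_bound f T v (t : seq nat) (M c : R) : valid (T, v) -> (forall s, 0 <= f s) ->
  perm_eq (neighbors T v) t -> (forall y, y \in t -> f (T, y) <= M%:E) ->
  (\sum_(y <- t) fine (f (T, y)) <= (size t)%:R * c)%R -> average f T v <= c%:E.
Proof.
move=> /deg_gt0 d0 f0 pt fM h.
have d0' : (0 < (size t)%:R :> R)%R by rewrite ltr0n -(perm_size pt).
rewrite /average (perm_big _ pt) /= /deg (perm_size pt).
suff -> : \sum_(y <- t) f (T, y) = (\sum_(y <- t) fine (f (T, y)))%:E.
  by rewrite -EFinM lee_fin ler_pdivrMr // mulrC.
rewrite -sumEFin big_seq [RHS]big_seq; apply: eq_bigr => y yt.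
by rewrite fineK // ge0_fin_numE // (le_lt_trans (fM _ yt)) ?ltry.
Qed.

Lemma fine_le_real (x : \bar R) (r : R) : 0 <= x -> x <= r%:E -> (fine x <= r)%R.
Proof. by case: x => //= x _; rewrite lee_fin. Qed.

End Kernel.

(** * A superharmonic function and the escape probability *)

Lemma below_trans T u w X : grown T -> w \in children T u -> X = w \/ below T w X ->
  below T u X.
Proof.
move=> gT wu [->|[z zw [j jX]]]; first exact: below_child.
exists w => //; exists j.+1; rewrite iterS jX; exact: parent_child zw.
Qed.

(* Exploration record of a vertex: [x] counts its exits to the parent, [a i] the entries
   into its [i]th child; [Waiting j x] still lacks [j + 1] children. *)
Inductive record :=
| Inactive
| Waiting of nat & nat
| Racing of nat & (nat -> nat) & (nat -> record).

Definition recruit j x :=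
  if j is j'.+1 then Waiting j' x else Racing x (fun=> 0%N) (fun=> Inactive).

(** The tracked children are the first three born: new leaves are appended to the list, so their
    positions never change. A waiting record may understate the number of children. *)
Fixpoint fits (T : tree) (u : nat) (c : record) : Prop :=
  match c with
  | Inactive => True
  | Waiting j _ => (3 <= size (children T u) + j.+1)%N
  | Racing _ _ sub => (3 <= size (children T u))%N /\
      forall i, (i < 3)%N -> fits T (nth 0%N (children T u) i) (sub i)
  end.

(** The walk is off the subtree, after [n] exits from it. Every tracked child has then been left as
    often as it was entered, hence the nested condition with [a i]. *)
Fixpoint outside (c : record) (n : nat) : Prop :=
  match c with
  | Inactive => n = 0%N
  | Waiting _ x => x = n
  | Racing x a sub => x = n /\ forall i, (i < 3)%N -> outside (sub i) (a i)
  end.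

(** The walk is in the subtree of [u], which was left [x] times. In the last alternative it is
    inside a tracked child, which has one exit less than entries. The other one also covers
    excursions below [u] that are not charged to any tracked child. *)
Fixpoint inside (T : tree) (X u : nat) (c : record) (x : nat) : Prop :=
  match c with
  | Inactive => False
  | Waiting _ x' => x' = x /\ (X = u \/ below T u X)
  | Racing x' a sub => x' = x /\
      ((X = u \/ below T u X) /\ (forall i, (i < 3)%N -> outside (sub i) (a i)) \/
       exists i, [/\ (i < 3)%N,
         exists2 y, a i = y.+1 & inside T X (nth 0%N (children T u) i) (sub i) y &
         forall j, (j < 3)%N -> j != i -> outside (sub j) (a j)])
  end.

Lemma fits_attach T v n u c : grown T -> fits T u c -> fits (attach T v n) u c.
Proof.
move=> gT; elim: c u => [//|j x|x a sub IH] u /=; rewrite children_attach size_cat; first lia.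
move=> [s3 h]; split=> [|i i3]; first by lia.
by rewrite nth_cat (leq_trans i3 s3); apply/IH/h.
Qed.

Lemma nth_children_attach T v n u i : (i < size (children T u))%N ->
  nth 0%N (children (attach T v n) u) i = nth 0%N (children T u) i.
Proof. by move=> h; rewrite children_attach nth_cat h. Qed.

Lemma fits_recruit T u j x : (3 <= size (children T u) + j)%N -> fits T u (recruit j x).
Proof. by case: j => [|j] //=; rewrite addn0. Qed.

Lemma outside_recruit j x : outside (recruit j x) x.
Proof. by case: j. Qed.

Lemma inside_recruit T X u j x : X = u \/ below T u X -> inside T X u (recruit j x) x.
Proof. by case: j => [|j] h //=; split=> //; left. Qed.

Lemma outside_inside T u c n : outside c n -> c <> Inactive -> inside T u u c n.
Proof.
case: c => [//|j x /= -> _|x a sub /= [-> h] _]; split=> //; first by left.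
by left; split=> //; left.
Qed.

Lemma inside_below T X u c x : grown T -> fits T u c -> inside T X u c x -> X = u \/ below T u X.
Proof.
move=> gT; elim: c u x => [//|j y|y a sub IH] u x /=; first by move=> _ [].
move=> [s3 h] [_ [[]//|[i [i3 [z _ /(IH _ _ _ (h _ i3)) hz] _]]]].
by right; apply: below_trans hz => //; rewrite mem_nth // (leq_trans i3 s3).
Qed.

Section Records.
Context {R : realType}.
Variables (ka g : R) (k : nat).

(** A supersolution for the extinction of the tracked descendants. A child not yet entered gets
    [1 - g], which by [supercritical] dominates the value of a fresh record. *)
Fixpoint value (c : record) : R :=
  match c with
  | Inactive => 1 - g
  | Waiting j x => setup ka g k j.+1 (k - x)
  | Racing x a sub =>
      mean_lost (k - x) (fun i => k - a i)%N (fun i => value (sub i))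
  end.

Hypotheses (ka0 : 0 < ka) (ka1 : ka <= 1) (g0 : 0 <= g) (g1 : g <= 1 / 3).
Hypotheses (k0 : (0 < k)%N) (supercritical : setup ka g k 3 k <= 1 - g).

Lemma value_bounds c : 0 <= value c <= 1.
Proof.
elim: c => [|j x|x a sub IH] /=.
- by move: (g0) (g1) => ? ?; lra.
- exact: setup_bounds.
- exact: mean_lost_bounds.
Qed.

Lemma value_recruit j x : value (recruit j x) <= setup ka g k j (k - x).
Proof. by case: j => [|j] //=; rewrite subn0; apply: mean_lost_setup => //; move: (g1); lra. Qed.

(** When the vertex has been left [k] times, each child entered [k] times has been left [k] times
    too, so inductively all factors are 1. *)
Lemma value_outside c n : outside c n -> (k <= n)%N -> value c = 1.
Proof.
elim: c n => [|j x|x a sub IH] n /=; first by move=> ->; rewrite leqNgt k0.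
  by move=> -> kn; rewrite (eqP kn).
move=> [-> h] kn; rewrite (eqP kn) mean_lost0; apply: big1 => -[i i3] _ /=.
by case: ifP => // /eqP ka_i; apply: (IH _ _ (h _ i3)); apply/eqP.
Qed.

Variables (Q : probability nat R) (f : tree * nat -> \bar R) (T : tree) (X : nat).
Hypotheses (Qka : leaf_laws ka Q) (f0 : forall s, (0 <= f s)%E) (vs : valid (T, X)).

(** The bound is required for every record admissible after the step. The map [al + be * _] carries
    the affine dependence of the ancestors' values on this record, which allows an induction into
    nested records. *)
Definition dominated u x (al be : R) := forall n y c',
  y \in neighbors (attach T X n) X -> fits (attach T X n) u c' ->
  inside (attach T X n) y u c' x \/ (y = parent (attach T X n) u /\ outside c' x.+1) ->
  (f (attach T X n, y) <= (al + be * value c')%:E)%E.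

Let gT : grown T. Proof. by case: vs. Qed.
Let XT : (X <= size T)%N. Proof. by case: vs. Qed.

Let gT' n : grown (attach T X n). Proof. exact: grown_attach. Qed.
Let XT' n : (X <= size (attach T X n))%N.
Proof. by rewrite size_attach (leq_trans XT) ?leq_addr. Qed.

Lemma step_below u c x al be : 0 <= al -> 0 <= be ->
  fits T u c -> below T u X ->
  (forall S y, (y = u \/ below S u y) -> inside S y u c x) -> dominated u x al be ->
  (kernel Q f (T, X) <= (al + be * value c)%:E)%E.
Proof.
move=> al0 be0 fc bX hc dom; apply: kernel_le_cst => //.
  by rewrite addr_ge0 ?mulr_ge0 //; case/andP: (value_bounds c).
move=> n y yX; apply: dom => //; first exact: fits_attach.
by left; apply: hc; apply: below_neighbor yX => //; exact: below_attach.
Qed.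

(** A move to a child uses up no exit, but charging one only increases [setup], so all moves share
    one bound. *)
Lemma step_recruit x al be n i y : 0 <= be -> dominated X x al be ->
  (3 <= size (children (attach T X n) X) + i)%N -> y \in neighbors (attach T X n) X ->
  (f (attach T X n, y) <= (al + be * setup ka g k i (k - x).-1)%:E)%E.
Proof.
move=> be0 dom hi yX.
have fi m : fits (attach T X n) X (recruit i m) by exact: fits_recruit.
have le (c : record) t : value c <= t -> ((al + be * value c)%:E <= (al + be * t)%:E)%E.
  by move=> ct; rewrite lee_fin lerD2l ler_wpM2l.
have [[_ yp]|yc] := mem_neighbors (gT' n) (XT' n) yX.
  apply: le_trans (dom n y (recruit i x.+1) yX (fi _) _) _.
    by right; split=> //; apply: outside_recruit.
  by apply: le; rewrite -subnS; apply: value_recruit.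
apply: le_trans (dom n y (recruit i x) yX (fi _) _) _.
  by left; apply: inside_recruit; right; apply: below_child.
apply: le; apply: le_trans (value_recruit _ _) _.
by case: (k - x)%N => [|m] //=; apply: setup_decr.
Qed.

Lemma step_waiting j x al be : 0 <= al -> 0 <= be ->
  fits T X (Waiting j x) -> dominated X x al be ->
  (kernel Q f (T, X) <= (al + be * setup ka g k j.+1 (k - x))%:E)%E.
Proof.
move=> al0 be0 /= fc dom.
have -> : setup ka g k j.+1 (k - x) =
    (1 - ka) * setup ka g k j.+1 (k - x).-1 + ka * setup ka g k j (k - x).-1.
  case: (k - x)%N => [|m] //=; ring.
rewrite [Y in Y%:E](_ : _ = (1 - ka) * (al + be * setup ka g k j.+1 (k - x).-1) +
  ka * (al + be * setup ka g k j (k - x).-1)); last by ring.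
apply: kernel_two => //.
- rewrite addr_ge0 ?mulr_ge0 //.
  by case/andP: (setup_bounds k ka0 ka1 g0 g1 j (k - x).-1).
- by rewrite lerD2l ler_wpM2l // setup_incr.
- have -> : T = attach T X 0 by rewrite /attach cats0.
  apply: average_le_cst => [|y yX]; first exact: valid_attach.
  by apply: step_recruit => //; rewrite children_attach size_cat; lia.
- move=> n n0; apply: average_le_cst => [|y yX]; first exact: valid_attach.
  by apply: step_recruit => //; rewrite children_attach size_cat eqxx size_iota; lia.
Qed.

(** The parent uses up an exit, a tracked child gains an entry, and any further child leaves the
    record as it is; the sum over neighbors is then [mean_lost_drift]. *)
Lemma step_racing x a sub al be : (0 < X)%N -> 0 <= al -> 0 <= be ->
  fits T X (Racing x a sub) -> (forall i, (i < 3)%N -> outside (sub i) (a i)) ->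
  dominated X x al be ->
  (kernel Q f (T, X) <= (al + be * value (Racing x a sub))%:E)%E.
Proof.
move=> X0 al0 be0 fc out dom; set c := Racing x a sub in fc *.
have vc0 : 0 <= value c by case/andP: (value_bounds c).
apply: kernel_average_le => // [|n]; first by rewrite addr_ge0 ?mulr_ge0.
set T' := attach T X n.
have [s3 fsub] : (3 <= size (children T' X))%N /\
    forall i, (i < 3)%N -> fits T' (nth 0%N (children T' X) i) (sub i).
  exact: (fits_attach X n gT fc).
pose psi i := value (sub i); pose nu i := (k - a i)%N; pose m := (k - x)%N.
have psi01 i : 0 <= psi i <= 1 by exact: value_bounds.
have bpar : (f (T', parent T' X) <= (al + be * mean_lost m.-1 nu psi)%:E)%E.
  have := dom n (parent T' X) (Racing x.+1 a sub); rewrite /= subnS; apply.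
  - by rewrite (perm_mem (perm_neighbors (gT' n) (XT' n))) mem_cat gtn_eqF // inE eqxx.
  - by split.
  - by right; split=> //; split.
have inner y : y \in children T' X -> y \in neighbors T' X.
  by move=> yc; rewrite (perm_mem (perm_neighbors (gT' n) (XT' n))) mem_cat yc orbT.
have brest y : y \in children T' X -> (f (T', y) <= (al + be * mean_lost m nu psi)%:E)%E.
  move=> yc; apply: (dom n y c); [exact: inner|exact: fits_attach|].
  by left; split=> //; left; split=> //; right; apply: below_child.
have bkid i : (i < 3)%N ->
    (f (T', nth 0%N (children T' X) i) <= (al + be * mean_lost m (step nu i) psi)%:E)%E.
  move=> i3; have ic : nth 0%N (children T' X) i \in children T' X.
    by rewrite mem_nth // (leq_trans i3).
  (* A child entered for the first time receives a fresh record, and this is where supercriticality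
     is used. *)
  have [c' [fc' ic' vc']] : exists c', [/\ fits T' (nth 0%N (children T' X) i) c',
      inside T' (nth 0%N (children T' X) i) (nth 0%N (children T' X) i) c' (a i) &
      value c' <= psi i].
    case: (pselect (sub i = Inactive)) => [e|ne].
      exists (recruit 3 0); split; first by apply: fits_recruit; rewrite leq_addl.
        have := out _ i3; rewrite e /= => ->.
        by apply: (@inside_recruit _ _ _ 3); left.
      apply: le_trans (value_recruit _ _) _; rewrite subn0 /psi e /=.
      exact: supercritical.
    by exists (sub i); split; [exact: fsub|apply: outside_inside => //; exact: out|].
  have := dom n (nth 0%N (children T' X) i) (Racing x (update a i (a i).+1) (update sub i c')).
  move=> /(_ (inner _ ic)) h; apply: le_trans (h _ _) _.
  - split=> // j j3; rewrite /update; case: eqP => [->//|_]; exact: fsub.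
  - left; split=> //; right; exists i; split=> //.
      by exists (a i); rewrite /update eqxx.
    by move=> j j3 ji; rewrite !update_neq //; apply: out.
  rewrite lee_fin lerD2l ler_wpM2l //=.
  have -> : (fun j => k - update a i (a i).+1 j)%N = step nu i.
    by apply/funext => j; rewrite /step /update /nu; case: eqP => //= _; rewrite subnS.
  have -> : (fun j => value (update sub i c' j)) = update psi i (value c').
    by apply/funext => j; rewrite /update; case: eqP.
  exact: mean_lost_le.
pose r := al + be.
have perm : perm_eq (neighbors T' X) (parent T' X :: children T' X).
  by have := perm_neighbors (gT' n) (XT' n); rewrite gtn_eqF.
have le_r t : 0 <= t <= 1 -> ((al + be * t)%:E <= r%:E)%E.
  by move=> /andP[_ t1]; rewrite lee_fin lerD2l -[leRHS]mulr1 ler_wpM2l.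
apply: (average_bound (valid_attach n vs) f0 perm (M := r)).
  move=> y; rewrite inE => /orP[/eqP ->|yc].
    by apply: le_trans bpar (le_r _ (mean_lost_bounds _ _ psi01)).
  exact: le_trans (brest _ yc) (le_r _ (mean_lost_bounds _ _ psi01)).
have := mean_lost_drift m nu psi01; rewrite big_ord3 /=.
have := bkid 0%N isT; have := bkid 1%N isT; have := bkid 2%N isT.
move: brest s3; rewrite -/T'; case: (children T' X) => [|c0 [|c1 [|c2 cs]]] //= brest _.
do 3 move=> /(fine_le_real (f0 _)) => ?.
move/(fine_le_real (f0 _)): bpar => bpar drift.
rewrite !big_cons; set v := value c in vc0 *.
have vE : v = mean_lost m nu psi by [].
have hs : \sum_(y <- cs) fine (f (T', y)) <= (size cs)%:R * (al + be * v).
  apply: (@le_trans _ _ (\sum_(y <- cs) (al + be * v))).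
    rewrite big_seq [leRHS]big_seq; apply: ler_sum => y ycs.
    by apply: fine_le_real => //; apply: brest; rewrite !inE ycs !orbT.
  by rewrite big_const_seq count_predT iter_addr_0 -[(_ + _) *+ _]mulr_natl.
rewrite -vE in drift *.
have := ler_wpM2l be0 drift; rewrite mulr0.
rewrite -[(size cs).+4%:R]natr1 -[(size cs).+3%:R]natr1 -[(size cs).+2%:R]natr1.
rewrite -[(size cs).+1%:R]natr1.
move: hs; set S := \sum_(y <- cs) _; set N := (size cs)%:R; nra.
Qed.

(** The step is analyzed at the innermost record that contains the walk; the records above it only
    contribute an affine map, absorbed into [al] and [be]. *)
Lemma inside_step c u x al be : (0 < u <= size T)%N -> 0 <= al -> 0 <= be ->
  fits T u c -> inside T X u c x -> dominated u x al be ->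
  (kernel Q f (T, X) <= (al + be * value c)%:E)%E.
Proof.
elim: c u x al be => [//|j y|y a sub IH] u x al be uT al0 be0 fc.
  move=> /= [yx loc] dom; case: loc => [Xu|bX].
    by move: fc dom; rewrite -Xu yx; apply: step_waiting.
  by apply: (step_below al0 be0 fc bX _ dom) => S z h; split.
move=> /= [yx loc] dom; subst y; case: loc => [[[Xu|bX] out]|].
- by move: fc dom uT; rewrite -Xu => fc dom /andP[u0 _]; apply: step_racing.
- by apply: (step_below al0 be0 fc bX _ dom) => S z h; split=> //; left.
move=> [i [i3 [y ay hin] out]].
have [s3 fsub] := fc; have si := leq_trans i3 s3.
set w := nth 0%N (children T u) i in hin.
have wc : w \in children T u by rewrite mem_nth.
have psi01 j : 0 <= value (sub j) <= 1 by exact: value_bounds.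
have [p [q [p0 q0 E]]] :=
  affine_mean_lost (k - x) (fun j => k - a j)%N i3 psi01.
have upd c' : (fun j => value (update sub i c' j)) = update (fun j => value (sub j)) i (value c').
  by apply/funext => j; rewrite /update; case: eqP.
have -> : al + be * mean_lost (k - x) (fun j => k - a j)%N (fun j => value (sub j)) =
    (al + be * p) + be * q * value (sub i).
  by rewrite -[X in mean_lost _ _ X](update_id _ i) E; ring.
apply: (IH i w y) => //.
- exact: (child_bounds gT wc).
- by rewrite addr_ge0 ?mulr_ge0.
- by rewrite mulr_ge0.
- exact: fsub.
move=> n z c' zX fc' loc.
have -> : al + be * p + be * q * value c' =
    al + be * mean_lost (k - x) (fun j => k - a j)%N (fun j => value (update sub i c' j)).
  by rewrite upd E; ring.
have nthE j : (j < 3)%N ->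
    nth 0%N (children (attach T X n) u) j = nth 0%N (children T u) j.
  by move=> j3; rewrite nth_children_attach // (leq_trans j3 s3).
have [s3' fsub'] := fits_attach X n gT (fc : fits T u (Racing x a sub)).
have out' j : (j < 3)%N -> j != i -> outside (update sub i c' j) (a j).
  by move=> j3 ji; rewrite update_neq //; apply: out.
apply: (dom n z (Racing x a (update sub i c'))) => //.
  split=> // j j3; rewrite nthE //; rewrite /update; case: eqP => [->//|_].
  by rewrite -nthE //; apply: fsub'.
left; split=> //; case: loc => [hz|[zp oz]].
  right; exists i; split=> //; exists y => //.
  by rewrite update_same nthE.
left; split.
  by left; rewrite zp; apply: parent_child => //; apply: mem_children_attach.
move=> j j3; case: (eqVneq j i) => [->|ji]; last exact: out'.
by rewrite update_same ay.
Qed.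

End Records.

(** * Escape probability from an arbitrary configuration *)

Section Escape.
Context {R : realType}.
Local Open Scope ereal_scope.

Fixpoint fall (Q : probability nat R) (l n : nat) (s : tree * nat) : \bar R :=
  if n is n'.+1
  then kernel Q (fun s' => if (depth s'.1 s'.2 < l)%N then 1 else fall Q l n' s') s
  else 0.

Lemma fall_ge0 Q l n s : 0 <= fall Q l n s.
Proof.
elim: n s => [|n IH] s //=; apply: kernel_ge0 => s'.
by case: ifP.
Qed.

Lemma fall_le1 Q l n T v : valid (T, v) -> fall Q l n (T, v) <= 1.
Proof.
elim: n T v => [|n IH] T v vs /=; first exact: lee01.
apply: kernel_le_cst => // [s|m y yv]; first by case: ifP => // _; apply: fall_ge0.
by case: ifP => // _; apply: IH; apply: valid_move yv.
Qed.

Variables (ka g : R) (k : nat) (Q : probability nat R).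
Hypotheses (ka0 : (0 < ka)%R) (ka1 : (ka <= 1)%R) (g0 : (0 <= g)%R) (g1 : (g <= 1 / 3)%R).
Hypotheses (k0 : (0 < k)%N) (supercritical : (setup ka g k 3 k <= 1 - g)%R).
Hypothesis Qka : leaf_laws ka Q.

(* The race between the parent of [v] and its child [w] is fair: [w] is entered [k] times
   before [v] is left with probability [2^-(k - a)] when [a] entries have been made. *)
Definition lure a t : R := (1 - 2^-1 ^+ (k - a) + 2^-1 ^+ (k - a) * t)%R.

(** Inside the subtree of [w] the bound is superharmonic by [inside_step]; at [v] it is preserved by
    the race of the parent against [w]; elsewhere below [v] nothing changes until the walk returns
    to [v]. *)
Lemma fall_tracked n T X v w c a : valid (T, X) -> (0 < v)%N -> w \in children T v ->
  fits T w c ->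
  (exists2 x, a = x.+1 & inside T X w c x) \/
  [/\ outside c a, c <> Inactive & X = v \/ below T v X] ->
  fall Q (depth T v) n (T, X) <= (lure a (value ka g k c))%:E.
Proof.
have half0 m : (0 <= 2^-1 ^+ m :> R)%R by rewrite exprn_ge0 // invr_ge0.
have half1 m : (2^-1 ^+ m <= 1 :> R)%R by rewrite exprn_ile1 ?invr_ge0 ?invf_le1 ?ler1n.
have vb c' := value_bounds k ka0 ka1 g0 g1 c'.
have lure0 b c' : (0 <= lure b (value ka g k c'))%R.
  by rewrite /lure; have /andP[? ?] := vb c'; have := half0 (k - b)%N; have := half1 (k - b)%N; nra.
elim: n T X c a => [|n IH] T X c a vs v0 wv fc loc; first by rewrite lee_fin.
have [gT XT] := vs; rewrite /= in gT XT.
rewrite [fall _ _ _ _]/=; set f := fun s' => _.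
have f0 s : 0 <= f s by rewrite /f; case: ifP => // _; apply: fall_ge0.
have /andP[w0 wT] := child_bounds gT wv.
have vT : (v <= size T)%N by rewrite -(parent_child gT wv); have := parent_le gT wT; lia.
have fE m y b c' : y \in neighbors (attach T X m) X -> (depth T v <= depth (attach T X m) y)%N ->
    fits (attach T X m) w c' ->
    (exists2 x, b = x.+1 & inside (attach T X m) y w c' x) \/
    [/\ outside c' b, c' <> Inactive & y = v \/ below (attach T X m) v y] ->
    f (attach T X m, y) <= (lure b (value ka g k c'))%:E.
  move=> yX dy fc' loc'; rewrite /f /= ltnNge dy /= -(depth_attach m gT XT vT).
  by apply: IH => //; [exact: valid_move yX|exact: mem_children_attach].
have gT' m : grown (attach T X m) by exact: grown_attach.
have XT' m : (X <= size (attach T X m))%N by rewrite size_attach (leq_trans XT) ?leq_addr.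
have dv m : depth (attach T X m) v = depth T v by exact: depth_attach.
have wv' m : w \in children (attach T X m) v by exact: mem_children_attach.
have deep m y : y \in neighbors (attach T X m) X -> y = v \/ below (attach T X m) v y ->
    (depth T v <= depth (attach T X m) y)%N.
  move=> yX [->|by_]; first by rewrite dv.
  by rewrite -(dv m) ltnW // below_depth // (neighbors_le yX).
case: loc => [[x ax hin]|[out nc [Xv|bX]]].
- apply: (inside_step ka0 ka1 g0 g1 k0 supercritical Qka f0 vs _ _ _ fc hin) => //.
  + by rewrite w0.
  + by rewrite subr_ge0.
  move=> m y c' yX fc' [hy|[yw oc]].
    apply: fE => //; last by left; exists x.
    apply: deep => //; right; apply: below_trans (wv' m) _ => //.
    exact: inside_below hy.
  have yv : y = v by rewrite yw; apply: parent_child.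
  apply: fE => //; first by apply: deep => //; left.
  right; rewrite ax; split=> //; last by left.
  by move=> e; move: oc; rewrite e.
(* After [k] exits from [w] the value is 1 and the bound is trivial. *)
- subst X; have [ka_|ak] := leqP k a.
    have -> : lure a (value ka g k c) = 1%R.
      by rewrite (value_outside ka g k0 out ka_) /lure; ring.
    apply: kernel_le_cst => // m y yX; rewrite /f; case: ifP => // _.
    by apply: fall_le1; apply: valid_move yX.
  apply: kernel_average_le => // m; set T' := attach T v m.
  have perm : perm_eq (neighbors T' v) (parent T' v :: w :: rem w (children T' v)).
    have := perm_neighbors (gT' m) (XT' m); rewrite gtn_eqF //= => h.
    by rewrite (perm_trans h) // perm_cons perm_to_rem.
  have f1 y : y \in neighbors T' v -> f (T', y) <= 1.
    move=> yX; rewrite /f; case: ifP => // _.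
    by apply: fall_le1; apply: valid_move yX.
  apply: (average_bound (valid_attach m vs) f0 perm (M := 1%R)).
    by move=> y; rewrite -(perm_mem perm) => /f1.
  rewrite !big_cons.
  have fp : (fine (f (T', parent T' v)) <= 1)%R.
    by apply: fine_le_real => //; apply: f1; rewrite (perm_mem perm) inE eqxx.
  have wn : w \in neighbors T' v by rewrite (perm_mem perm) !inE eqxx orbT.
  have fw : (fine (f (T', w)) <= lure a.+1 (value ka g k c))%R.
    apply: fine_le_real => //; apply: fE => //.
    - by apply: deep => //; right; apply: below_child.
    - exact: fits_attach.
    - by left; exists a => //; apply: outside_inside.
  have fr : (\sum_(y <- rem w (children T' v)) fine (f (T', y)) <=
      (size (rem w (children T' v)))%:R * lure a (value ka g k c))%R.
    apply: (@le_trans _ _ (\sum_(y <- rem w (children T' v)) lure a (value ka g k c))%R).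
      rewrite big_seq [leRHS]big_seq; apply: ler_sum => y yr.
      have yc : y \in children T' v by apply: mem_rem yr.
      have yn : y \in neighbors T' v by rewrite (perm_mem perm) !inE yr !orbT.
      apply: fine_le_real => //; apply: fE => //.
      - by apply: deep => //; right; apply: below_child.
      - exact: fits_attach.
      - by right; split=> //; right; apply: below_child.
    by rewrite big_const_seq count_predT iter_addr_0 -[(lure _ _ *+ _)%R]mulr_natl.
  (* The parent and [w] balance exactly; all other children keep the bound [lure a]. *)
  have hal : (1 + lure a.+1 (value ka g k c) = 2 * lure a (value ka g k c))%R.
    rewrite /lure; have -> : (k - a = (k - a.+1).+1)%N by rewrite subnSK.
    by rewrite exprS; field.
  rewrite /= -[(size (rem w (children T' v))).+2%:R]natr1.
  rewrite -[(size (rem w (children T' v))).+1%:R]natr1.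
  by move: fr hal fp fw; lra.
- apply: kernel_le_cst => // m y yX.
  have yb : y = v \/ below (attach T X m) v y.
    by apply: below_neighbor yX => //; apply: below_attach.
  by apply: fE => //; [exact: deep|exact: fits_attach|right; split].
Qed.

(** With probability at least [ka] a leaf is attached at once, so that [v] has a child; a child is
    then entered with probability at least 1/2, and from it the walk escapes with probability at
    least [e]. *)
Lemma fall_escape n T v : valid (T, v) -> (0 < v)%N ->
  fall Q (depth T v) n (T, v) <= (1 - ka * g / 2 ^+ k)%:E.
Proof.
have h2 : (1 <= 2 ^+ k :> R)%R by rewrite exprn_ege1 // ler1n.
have hg : (ka * g / 2 ^+ k <= 1)%R.
  rewrite ler_pdivrMr; last by lra.
  by move: (ka0) (ka1) (g0) (g1) => ? ? ? ?; nra.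
case: n => [|n] vs v0; first by rewrite lee_fin subr_ge0.
have [gT vT] := vs; rewrite /= in gT vT.
rewrite [fall _ _ _ _]/=; set f := fun s' => _.
have f0 s : 0 <= f s by rewrite /f; case: ifP => // _; apply: fall_ge0.
have f1 m y : y \in neighbors (attach T v m) v -> f (attach T v m, y) <= 1.
  move=> yX; rewrite /f; case: ifP => // _.
  by apply: fall_le1; apply: valid_move yX.
pose e : R := (g * 2^-1 ^+ k.-1)%R.
have e0 : (0 <= e)%R by rewrite mulr_ge0 // exprn_ge0 // invr_ge0.
have e1 : (e <= 1)%R.
  have : (2^-1 ^+ k.-1 <= 1 :> R)%R by rewrite exprn_ile1 ?invr_ge0 ?invf_le1 ?ler1n.
  by move: (g0) (g1); rewrite /e => ? ?; nra.
have -> : (1 - ka * g / 2 ^+ k = (1 - ka) * 1 + ka * (1 - e / 2))%R.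
  rewrite /e -(prednK k0) /= exprS exprVn; field.
  by rewrite expf_neq0 // pnatr_eq0.
apply: kernel_two => //.
- lra.
- lra.
- by apply: average_le_cst => // y yv; have := f1 0%N y; rewrite /attach cats0; apply.
move=> m m0; set T' := attach T v m.
have gT' : grown T' by exact: grown_attach.
have vT' : (v <= size T')%N by rewrite size_attach (leq_trans vT) ?leq_addr.
have perm : perm_eq (neighbors T' v) (parent T' v :: children T' v).
  by have := perm_neighbors gT' vT'; rewrite gtn_eqF.
apply: (average_bound (valid_attach m vs) f0 perm (M := 1%R)).
  by move=> y; rewrite -(perm_mem perm) => /f1.
rewrite big_cons.
have fp : (fine (f (T', parent T' v)) <= 1)%R.
  by apply: fine_le_real => //; apply: f1; rewrite (perm_mem perm) inE eqxx.
have fc : (\sum_(y <- children T' v) fine (f (T', y)) <= (size (children T' v))%:R * (1 - e))%R.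
  apply: (@le_trans _ _ (\sum_(y <- children T' v) (1 - e))%R).
    rewrite big_seq [leRHS]big_seq; apply: ler_sum => y yc.
    have yn : y \in neighbors T' v by rewrite (perm_mem perm) inE yc orbT.
    apply: fine_le_real => //; rewrite /f.
    have dy : (depth T v < depth T' y)%N.
      by rewrite -(depth_attach m gT vT vT) below_depth ?(neighbors_le yn) //; apply: below_child.
    rewrite /= ltnNge (ltnW dy) /= -(depth_attach m gT vT vT).
    (* The step into [y] counts as its first entry, and its record starts afresh. *)
    apply: le_trans (fall_tracked (c := recruit 3 0) (a := 1) n _ v0 yc _ _) _.
    - exact: valid_move yn.
    - by apply: fits_recruit; rewrite leq_addl.
    - left; exists 0%N => //.
      by apply: (@inside_recruit _ _ _ 3); left.
    rewrite lee_fin /lure subn1.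
    have := value_recruit ka g0 g1 k0 3 0; rewrite subn0 => h.
    have : (2^-1 ^+ k.-1 * value ka g k (recruit 3 0) <= 2^-1 ^+ k.-1 * (1 - g))%R.
      by rewrite ler_wpM2l ?exprn_ge0 ?invr_ge0 //; apply: le_trans h supercritical.
    by rewrite /e; lra.
  by rewrite big_const_seq count_predT iter_addr_0 -[((1 - e) *+ _)%R]mulr_natl.
have s1 : (1 <= (size (children T' v))%:R :> R)%R.
  by rewrite ler1n children_attach eqxx size_cat size_iota ltn_addl.
rewrite /= -[(size (children T' v)).+1%:R]natr1.
move: s1 fc fp; set N := (size _)%:R; set S := (\sum_(y <- _) _)%R => s1 fc fp.
by move: e0; nra.
Qed.

End Escape.

(** * Levels of the walk *)

Definition level (s : tree * nat) := depth s.1 s.2.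

Lemma level_attach T v n : valid (T, v) -> depth (attach T v n) v = depth T v.
Proof. by move=> [gT vT]; apply: depth_attach. Qed.

Lemma level_move T v n y : valid (T, v) -> y \in neighbors (attach T v n) v ->
  depth T v = (level (attach T v n, y)).+1 \/ level (attach T v n, y) = (depth T v).+1.
Proof.
move=> vs yv; have [gT' vT'] := valid_attach n vs.
by rewrite -(level_attach n vs); apply: depth_neighbor.
Qed.

(** * Finite-horizon expectations of the level path *)

Section Expectation.
Context {R : realType}.
Local Open Scope ereal_scope.
Variable Q : probability nat R.
Implicit Types (phi psi : seq nat -> \bar R) (s : tree * nat) (b : pred (seq nat)).

(* [phi] is applied to the levels of the next [n] states, the current one excluded. *)
Fixpoint expect n s phi : \bar R :=
  if n is n'.+1
  then kernel Q (fun s' => expect n' s' (fun p => phi (level s' :: p))) s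
  else phi [::].

Definition chance n s (b : pred (seq nat)) := expect n s (fun p => (b p)%:R%:E).

Lemma expect_ge0 n s phi : (forall p, 0 <= phi p) -> 0 <= expect n s phi.
Proof.
by elim: n s phi => [|n IH] s phi h //=; apply: kernel_ge0 => s'; apply: IH.
Qed.

Lemma expect_le n s phi psi : (forall p, 0 <= phi p) -> (forall p, phi p <= psi p) ->
  expect n s phi <= expect n s psi.
Proof.
elim: n s phi psi => [|n IH] [T v] phi psi h0 h //=.
by apply: kernel_le => [s'|m y _]; [apply: expect_ge0|apply: IH].
Qed.

Lemma expect_add n s phi psi : (forall p, 0 <= phi p) -> (forall p, 0 <= psi p) ->
  expect n s (fun p => phi p + psi p) = expect n s phi + expect n s psi.
Proof.
elim: n s phi psi => [|n IH] [T v] phi psi h0 h1 //=.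
rewrite -kernel_add; [|by move=> s; apply: expect_ge0|by move=> s; apply: expect_ge0].
by congr (kernel Q _ _); apply/funext => s; apply: IH.
Qed.

Lemma expect_scale n s phi (c : R) : (0 <= c)%R -> (forall p, 0 <= phi p) ->
  expect n s (fun p => c%:E * phi p) = c%:E * expect n s phi.
Proof.
move=> c0; elim: n s phi => [|n IH] [T v] phi h0 //=.
rewrite -kernel_scale //; last by move=> s; apply: expect_ge0.
by congr (kernel Q _ _); apply/funext => s; apply: IH.
Qed.

Lemma expect_cst n T v (c : R) : (0 <= c)%R -> valid (T, v) ->
  expect n (T, v) (fun=> c%:E) = c%:E.
Proof.
move=> c0; elim: n T v => [|n IH] T v vs //=.
rewrite -[RHS](kernel_cst Q c0 vs); apply/eqP; rewrite eq_le; apply/andP; split.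
  by apply: kernel_le => [s|m y yv]; [apply: expect_ge0|rewrite IH //; exact: valid_move yv].
by apply: kernel_le => [s|m y yv] //; rewrite IH //; exact: valid_move yv.
Qed.

Lemma chance_ge0 n s b : 0 <= chance n s b.
Proof. by apply: expect_ge0 => p; rewrite lee_fin. Qed.

Lemma chance_le n s b b' : (forall p, b p -> b' p) -> chance n s b <= chance n s b'.
Proof.
move=> h; apply: expect_le => p; rewrite lee_fin // ler_nat.
by case e: (b p) => //; rewrite h.
Qed.

Lemma chance_le1 n T v b : valid (T, v) -> chance n (T, v) b <= 1.
Proof.
move=> vs; rewrite -[leRHS](expect_cst n (@ler01 R) vs); apply: expect_le => p.
  by rewrite lee_fin.
by rewrite lee_fin lern1 leq_b1.
Qed.

Lemma chance0 n T v b : valid (T, v) -> (forall p, ~~ b p) -> chance n (T, v) b = 0.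
Proof.
move=> vs h; rewrite -[RHS](expect_cst n (lexx (0%R : R)) vs).
by congr (expect _ _ _); apply/funext => p; rewrite (negbTE (h p)).
Qed.

Lemma chance1 n T v b : valid (T, v) -> (forall p, b p) -> chance n (T, v) b = 1.
Proof.
move=> vs h; rewrite -[RHS](expect_cst n (@ler01 R) vs).
by congr (expect _ _ _); apply/funext => p; rewrite h.
Qed.

Lemma chance_or n s b b' :
  chance n s (fun p => b p || b' p) <= chance n s b + chance n s b'.
Proof.
rewrite -expect_add; [|by move=> p; rewrite lee_fin..].
apply: expect_le => p; first by rewrite lee_fin.
by rewrite -EFinD lee_fin -natrD ler_nat; case: (b p); case: (b' p).
Qed.

Lemma chance_step n s b :
  chance n.+1 s b = kernel Q (fun s' => chance n s' (fun p => b (level s' :: p))) s.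
Proof. by []. Qed.

Lemma fall_chance l n T v : valid (T, v) ->
  fall Q l n (T, v) = chance n (T, v) (has (fun d => d < l)%N).
Proof.
elim: n T v => [|n IH] T v vs //; rewrite chance_step /=.
have E m y : y \in neighbors (attach T v m) v ->
   (if (depth (attach T v m) y < l)%N then 1 else fall Q l n (attach T v m, y)) =
   chance n (attach T v m, y)
     (fun p => has (fun d => d < l)%N (level (attach T v m, y) :: p)).
  move=> yv; have vs' := valid_move vs yv.
  rewrite /= /level /=; case: ltnP => _ /=; first by rewrite chance1.
  by rewrite IH.
apply/eqP; rewrite eq_le; apply/andP; split; apply: kernel_le => [s|m y yv].
- by case: ifP => // _; apply: fall_ge0.
- by rewrite /= E.
- exact: chance_ge0.
- by rewrite /= E.
Qed.

End Expectation.

(** * Descents and failed renewal attempts *)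

Section Levels.
Context {R : realType}.
Local Open Scope ereal_scope.
Variables (Q : probability nat R) (rho : R).
Hypotheses (rho0 : (0 <= rho)%R) (rho1 : (rho < 1)%R).
Hypothesis escape : forall n T v, valid (T, v) -> (0 < v)%N ->
  fall Q (depth T v) n (T, v) <= rho%:E.

Let root_level T v b : valid (T, v) -> depth T v = b.+1 -> (0 < v)%N.
Proof. by case: v => //; rewrite depth0. Qed.

(** Levels change by one, so the walk stands at level [b + 1] exactly before it falls below it, and
    [escape] applies there afresh. *)
Lemma fall_next b n T v : valid (T, v) -> (b.+1 < depth T v)%N ->
  fall Q b.+1 n (T, v) <= rho%:E * fall Q b.+2 n (T, v).
Proof.
elim: n T v => [|n IH] T v vs dv /=; first by rewrite mule0.
rewrite -kernel_scale //; last by move=> s; case: ifP => // _; apply: fall_ge0.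
apply: kernel_le => [s|m y yv]; first by case: ifP => // _; apply: fall_ge0.
have vs' := valid_move vs yv; have := level_move vs yv; rewrite /level /= => dy.
have -> : (depth (attach T v m) y < b.+1)%N = false by lia.
case: ltnP => dy'; last exact: IH.
have e : depth (attach T v m) y = b.+1 by lia.
by rewrite mule1 -e; apply: escape => //; apply: root_level e.
Qed.

Lemma fall_descend b n j T v : valid (T, v) -> depth T v = (b.+1 + j)%N ->
  fall Q b.+1 n (T, v) <= (rho ^+ j.+1)%:E.
Proof.
elim: j b => [|j IH] b vs dv.
  rewrite expr1; rewrite addn0 in dv; rewrite -dv.
  by apply: escape => //; apply: root_level dv.
apply: le_trans (fall_next _ vs _) _; first by lia.
rewrite exprS EFinM lee_wpmul2l //; apply: IH => //; lia.
Qed.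

(* The running maximum, started at [M], when level [b] is first undercut. *)
Fixpoint peak (M b : nat) (p : seq nat) : option nat :=
  if p is d :: p' then (if d < b then Some M else peak (maxn M d) b p')%N else None.

Lemma peak_ge M b p M' : peak M b p = Some M' -> (M <= M')%N.
Proof.
elim: p M => //= d p IH M; case: ifP => _; first by case=> ->.
by move/IH; apply: leq_trans; apply: leq_maxl.
Qed.

Definition peak_above l M b p := if peak M b p is Some M' then (l <= M')%N else false.

Lemma peak_has l M b p : peak_above l M b p -> has (fun d => d < b)%N p.
Proof.
by elim: p M => [//|d p IH] M; rewrite /peak_above /=; case: ltnP => //= _ /IH.
Qed.

(** Such a peak forces a visit to level [b + 1 + j], followed by a descent of [j + 1] levels. *)
Lemma chance_climb b j n M T v : valid (T, v) -> (b < depth T v <= M)%N ->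
  (M < b.+1 + j)%N ->
  chance Q n (T, v) (peak_above (b.+1 + j) M b.+1) <= (rho ^+ j.+1)%:E.
Proof.
have rj0 : 0 <= (rho ^+ j.+1)%:E by rewrite lee_fin exprn_ge0.
elim: n M T v => [|n IH] M T v vs dv Mj; first by [].
rewrite chance_step; apply: kernel_le_cst => //; first by move=> s; apply: chance_ge0.
move=> m y yv; have vs' := valid_move vs yv; have dy := level_move vs yv.
rewrite /peak_above /=; case: ltnP => db.
  by rewrite chance0 // => p; rewrite -ltnNge.
have [dj|dj] := ltnP (level (attach T v m, y)) (b.+1 + j).
  apply: IH => //; last by rewrite gtn_max Mj.
  by rewrite -[depth _ _]/(level (attach T v m, y)) db leq_maxr.
have dE : level (attach T v m, y) = (b.+1 + j)%N by lia.
apply: le_trans (fall_descend n vs' dE); rewrite fall_chance //; apply: chance_le => p.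
exact: peak_has.
Qed.

Lemma chance_climb0 b j n T v : valid (T, v) -> depth T v = b.+1 ->
  chance Q n (T, v) (peak_above (b.+1 + j) b.+1 b.+1) <= (rho ^+ j.+1)%:E.
Proof.
move=> vs dv; case: j => [|j]; last by apply: chance_climb; rewrite ?dv //; lia.
have dv' : depth T v = (b.+1 + 0)%N by rewrite addn0.
apply: le_trans (fall_descend n vs dv'); rewrite fall_chance //; apply: chance_le => p.
exact: peak_has.
Qed.

Variable y : R.
Hypotheses (y1 : (1 < y)%R) (yrho : (y * rho < 1)%R).
(** The left side is the sum of [rho] and of [(y^j - y^(j-1)) * rho^(j+1)] over [j >= 1]; it bounds
    the mean of [y^(peak - record)] on failure. *)
Hypothesis small : (rho + (y - 1) * rho ^+ 2 / (1 - y * rho) <= y^-1)%R.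

(** The cap at [m] keeps the weight bounded; heights beyond [m] are irrelevant for [bad]. *)
Definition gain m M b p : \bar R :=
  if peak M b p is Some M' then (y ^+ minn M' m)%:E else 0.

Lemma y_ge0 : (0 <= y)%R. Proof. by rewrite ltW // (lt_trans ltr01). Qed.

Lemma gain_ge0 m M b p : 0 <= gain m M b p.
Proof. by rewrite /gain; case: peak => // M'; rewrite lee_fin exprn_ge0 // y_ge0. Qed.

(* Abel summation of [y ^ M] over the record levels reached before the undercut. *)
Lemma expect_gain_cap b j n T v : valid (T, v) -> depth T v = b.+1 ->
  expect Q n (T, v) (gain (b.+1 + j) b.+1 b.+1) <=
  (y ^+ b.+1 * (rho + (y - 1) * rho ^+ 2 * (1 - (y * rho) ^+ j) / (1 - y * rho)))%:E.
Proof.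
move=> vs dv; elim: j => [|j IH].
  rewrite expr0 subrr mulr0 mul0r addr0 EFinM.
  apply: (@le_trans _ _ (expect Q n (T, v)
    (fun p => (y ^+ b.+1)%:E * (peak_above (b.+1 + 0) b.+1 b.+1 p)%:R%:E))).
    apply: expect_le => p; first exact: gain_ge0.
    rewrite /gain /peak_above; move: (@peak_ge b.+1 b.+1 p).
    case: peak => [M'|_]; last by rewrite mule0.
    move=> /(_ _ erefl) h; by rewrite addn0 h mule1 (minn_idPr h).
  rewrite expect_scale ?exprn_ge0 ?y_ge0 //.
  rewrite lee_wpmul2l ?lee_fin ?exprn_ge0 ?y_ge0 //.
  by have := chance_climb0 0 n vs dv; rewrite expr1.
have d0 : (0 <= y ^+ (b.+1 + j).+1 - y ^+ (b.+1 + j))%R.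
  by rewrite subr_ge0 exprS ler_peMl ?exprn_ge0 ?y_ge0 // ltW.
apply: (@le_trans _ _ (expect Q n (T, v) (gain (b.+1 + j) b.+1 b.+1) +
   expect Q n (T, v) (fun p => (y ^+ (b.+1 + j).+1 - y ^+ (b.+1 + j))%:E *
      (peak_above (b.+1 + j.+1) b.+1 b.+1 p)%:R%:E))).
  rewrite -expect_add.
  - apply: expect_le => p; first exact: gain_ge0.
    rewrite /gain /peak_above; case: peak => [M'|]; last by rewrite mule0 adde0.
    rewrite addnS; case: ltnP => h.
      by rewrite mule1 (minn_idPr h) -EFinD subrKC.
    by rewrite mule0 adde0 (minn_idPl (leqW h)).
  - by move=> p; apply: gain_ge0.
  - by move=> p; rewrite mule_ge0 // lee_fin.
rewrite expect_scale //.
apply: le_trans (leeD IH (lee_wpmul2l _ (chance_climb0 j.+1 n vs dv))) _.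
  by rewrite lee_fin.
rewrite -EFinM -EFinD lee_fin le_eqVlt; apply/orP; left; apply/eqP.
have h1 : (1 - y * rho != 0)%R by rewrite subr_eq0 gt_eqF.
rewrite exprMn exprD !exprS exprMn [(y ^+ (b + j))%R]exprD; field.
exact: h1.
Qed.

(** The bound is [y^b] although the record level is [b + 1]: the factor [y] saved here pays for the
    next attempt starting one level above the peak. *)
Lemma expect_gain m b n T v : valid (T, v) -> depth T v = b.+1 -> (b < m)%N ->
  expect Q n (T, v) (gain m b.+1 b.+1) <= (y ^+ b)%:E.
Proof.
move=> vs dv bm; have := expect_gain_cap (m - b.+1) n vs dv; rewrite subnKC //.
move=> h; apply: le_trans h _; rewrite lee_fin.
have y0 : (0 < y)%R by apply: lt_trans y1.
apply: (@le_trans _ _ (y ^+ b.+1 * y^-1)%R); last by rewrite exprSr mulfK // gt_eqF.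
rewrite ler_wpM2l ?exprn_ge0 ?y_ge0 //; apply: le_trans small.
rewrite lerD2l ler_pM2r ?invr_gt0 ?subr_gt0 //.
rewrite ler_piMr ?mulr_ge0 ?exprn_ge0 ?subr_ge0 ?(ltW y1) //.
by rewrite gerBl exprn_ge0 // mulr_ge0 // y_ge0.
Qed.

(* Successive attempts at a renewal: [Some b] while the walk has not undercut the record
   level [b] of the current attempt, [None] until the next record after [b] was undercut.
   The path is bad when an attempt has failed after the record level reached [m]. *)
Fixpoint bad (m : nat) (attempt : option nat) (M : nat) (p : seq nat) : bool :=
  match attempt with
  | None => (m <= M)%N || match p with
            | [::] => false
            | d :: p' => if (M < d)%N then bad m (Some d) d p' else bad m None M p'
            end
  | Some b => match p with
              | [::] => false
              | d :: p' => if (d < b)%N then bad m None M p' else bad m (Some b) (maxn M d) p'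
              end
  end.

Lemma chance_bad m n T v M b : valid (T, v) ->
  ((depth T v <= M)%N ->
     chance Q n (T, v) (bad m None M) <= (y ^+ (minn M m).+1 / y ^+ m)%:E) /\
  ((b < depth T v <= M)%N -> chance Q n (T, v) (bad m (Some b.+1) M) <=
     (y / y ^+ m)%:E * expect Q n (T, v) (gain m M b.+1)).
Proof.
have y0 : (0 < y)%R by apply: lt_trans y1.
have yX i : (0 < y ^+ i)%R by rewrite exprn_gt0.
have wait0 M' : (0 <= y ^+ (minn M' m).+1 / y ^+ m)%R by rewrite divr_ge0 ?ltW.
have wait1 M' p n' T' v' : valid (T', v') -> (m <= M')%N ->
    chance Q n' (T', v') p <= (y ^+ (minn M' m).+1 / y ^+ m)%:E.
  move=> vs mM; apply: (le_trans (chance_le1 Q _ _ vs)).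
  by rewrite (minn_idPr mM) lee_fin exprS mulfK ?gt_eqF // ltW.
elim: n T v M b => [|n IH] T v M b vs.
  split=> dv; last by rewrite mule_ge0 ?gain_ge0 // lee_fin divr_ge0 ?ltW.
  case: (boolP (m <= M)%N) => [mM|]; [exact: wait1|rewrite -ltnNge => Mm].
  by rewrite /chance /= leqNgt Mm /= lee_fin.
split=> dv.
  case: (boolP (m <= M)%N) => [mM|]; [exact: wait1|rewrite -ltnNge => Mm].
  rewrite chance_step; apply: kernel_le_cst => // [s|k z zv]; first exact: chance_ge0.
  have vs' := valid_move vs zv; have dz := level_move vs zv.
  rewrite /= leqNgt Mm /=; case: ltnP => dM; last by have [+ _] := IH _ _ M 0%N vs'; apply.
  have dE : level (attach T v k, z) = M.+1 by move: dz dM; rewrite /level /=; lia.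
  have [_ +] := IH _ _ M.+1 M vs'; rewrite -[depth _ _]/(level (attach T v k, z)) dE.
  rewrite !ltnSn => /(_ isT) h; apply: le_trans h _.
  apply: le_trans (lee_wpmul2l _ (expect_gain n vs' dE Mm)) _.
    by rewrite lee_fin divr_ge0 ?ltW.
  by rewrite -EFinM lee_fin (minn_idPl (ltnW Mm)) exprS mulrAC.
rewrite chance_step /= -kernel_scale; last 2 first.
- by rewrite divr_ge0 ?ltW.
- by move=> s; apply: expect_ge0 => p; apply: gain_ge0.
apply: kernel_le => [s|k z zv]; first exact: chance_ge0.
have vs' := valid_move vs zv; have dz := level_move vs zv.
rewrite /= /gain /=; case: ltnP => db.
  rewrite expect_cst ?(ltW (yX _)) // -EFinM mulrAC -exprS.
  have [+ _] := IH _ _ M 0%N vs'; apply.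
  by move: dz db; rewrite /level /=; lia.
have [_ +] := IH _ _ (maxn M (level (attach T v k, z))) b vs'; apply.
by rewrite -[depth _ _]/(level (attach T v k, z)) db leq_maxr.
Qed.

End Levels.

(** * Repeated visits to a level *)

Section Visits.
Context {R : realType}.
Local Open Scope ereal_scope.
Variables (Q : probability nat R) (ka rho : R).
Hypotheses (ka0 : (0 < ka)%R) (ka1 : (ka <= 1)%R) (rho0 : (0 <= rho)%R) (rho1 : (rho < 1)%R).
Hypothesis Qka : leaf_laws ka Q.
Hypothesis escape : forall n T v, valid (T, v) -> (0 < v)%N ->
  fall Q (depth T v) n (T, v) <= rho%:E.

Definition return_bound : R := ((1 - ka) * 1 + ka * ((1 + rho) / 2))%R.

Definition visits l i (p : seq nat) := (i <= count (pred1 l) p)%N.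

Lemma return_bound_ge0 : (0 <= return_bound)%R.
Proof.
by move: (ka0) (ka1) (rho0) => ? ? ?; rewrite /return_bound addr_ge0 ?mulr_ge0 //; lra.
Qed.

(** With probability at least [ka] the vertex has a child after the growth; a step to a child has
    then probability at least 1/2, and coming back to the level from there is a fall. *)
Lemma chance_return n T v : valid (T, v) ->
  chance Q n (T, v) (visits (depth T v) 1) <= return_bound%:E.
Proof.
case: n => [|n] vs; first by rewrite /chance /= lee_fin return_bound_ge0.
move: (ka0) (ka1) (rho0) (rho1) => ka0' ka1' rho0' rho1'.
rewrite chance_step; set f := fun s' => _.
have f0 s : 0 <= f s by apply: chance_ge0.
have f1 m y : y \in neighbors (attach T v m) v -> f (attach T v m, y) <= 1.
  by move=> yv; apply: chance_le1; apply: valid_move yv.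
apply: kernel_two => //.
- lra.
- lra.
- by apply: average_le_cst => // y yv; have := f1 0%N y; rewrite /attach cats0; apply.
move=> m m0; set T' := attach T v m; have [gT' vT'] := valid_attach m vs.
have fc y : y \in children T' v -> f (T', y) <= rho%:E.
  move=> yc; have yn : y \in neighbors T' v.
    by rewrite (perm_mem (perm_neighbors gT' vT')) mem_cat yc orbT.
  have vs' := valid_move vs yn; have /andP[y0 yT] := child_bounds gT' yc.
  have dy : depth T' y = (depth T v).+1.
    by rewrite depthS ?y0 // (parent_child gT' yc) level_attach.
  apply: le_trans (escape n vs' y0); rewrite fall_chance // dy.
  apply: chance_le => p; rewrite /visits /level /= dy gtn_eqF // add0n -has_count.
  by apply: sub_has => d /= /eqP ->.
have perm := perm_neighbors gT' vT'.
apply: (average_bound (valid_attach m vs) f0 perm (M := 1%R)).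
  by move=> y; rewrite -(perm_mem perm) => /f1.
rewrite big_cat size_cat natrD /=.
have hc : (\sum_(y <- children T' v) fine (f (T', y)) <= (size (children T' v))%:R * rho)%R.
  apply: (@le_trans _ _ (\sum_(y <- children T' v) rho)%R).
    by rewrite big_seq [leRHS]big_seq; apply: ler_sum => y /fc; apply: fine_le_real.
  by rewrite big_const_seq count_predT iter_addr_0 -[(rho *+ _)%R]mulr_natl.
have s1 : (1 <= (size (children T' v))%:R :> R)%R.
  by rewrite ler1n children_attach eqxx size_cat size_iota; lia.
have hp : (\sum_(y <- if v == 0%N then [::] else [:: parent T' v]) fine (f (T', y)) <=
    (size (if v == 0%N then [::] else [:: parent T' v]))%:R)%R.
  case: eqP => v0; first by rewrite big_nil.
  rewrite big_seq1; apply: fine_le_real => //; apply: f1.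
  by rewrite (perm_mem perm) mem_cat; case: eqP => //= _; rewrite inE eqxx.
move: hp; have : (size (if v == 0%N then [::] else [:: parent T' v]) <= 1)%N by case: eqP.
rewrite -(@ler_nat R); set A := (\sum_(y <- if _ then _ else _) _)%R; set N := (size _)%:R.
by move: hc s1; set B := (\sum_(y <- _) _)%R; set C := (size _)%:R; nra.
Qed.

(** The walk may meet the level at a different vertex each time; [chance_return] is uniform over
    states, so every further visit costs one factor. *)
Lemma chance_visits_next l i n T v : valid (T, v) ->
  chance Q n (T, v) (visits l i.+1) <=
  (return_bound ^+ i)%:E * chance Q n (T, v) (visits l 1).
Proof.
have r0 := return_bound_ge0.
elim: n i T v => [|n IH] i T v vs; first by rewrite /chance /= mule0.
rewrite !chance_step -kernel_scale; last 2 first.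
- by rewrite exprn_ge0.
- by move=> s; apply: chance_ge0.
apply: kernel_le => [s|m y yv]; first exact: chance_ge0.
have vs' := valid_move vs yv.
rewrite /visits /=; case: eqP => dl; last exact: IH.
rewrite [X in _ <= _ * X]chance1 // mule1.
case: i => [|i]; first by rewrite expr0; apply: chance_le1.
apply: le_trans (IH i _ _ vs') _.
rewrite exprSr EFinM lee_wpmul2l ?lee_fin ?exprn_ge0 // -dl.
exact: chance_return.
Qed.

Lemma chance_visits l i n T v : valid (T, v) ->
  chance Q n (T, v) (visits l i.+1) <= (return_bound ^+ i)%:E.
Proof.
move=> vs; apply: le_trans (chance_visits_next l i n vs) _.
rewrite -[leRHS]mule1 lee_wpmul2l ?chance_le1 //.
by rewrite lee_fin exprn_ge0 // return_bound_ge0.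
Qed.

End Visits.

(** * Deterministic paths: failed attempts or many visits to one level *)

Definition undercut_records (n M : nat) (p : seq nat) : Prop :=
  forall i, (i < n)%N -> (i < size p)%N -> (M < nth 0 p i)%N ->
    (forall j, (j < i)%N -> (nth 0 p j < nth 0 p i)%N) ->
  exists j, [/\ (i < j)%N, (j < size p)%N & (nth 0 p j < nth 0 p i)%N].

(** The scan in [bad] only starts attempts at records, all undercut by assumption when they lie in
    the first [n] entries. So the current attempt always ends, until one ends with maximum at least
    [m]. *)
Lemma bad_undercut m n M p :
  (m <= M)%N \/ (exists i, [/\ (i < n)%N, (i < size p)%N & (m <= nth 0 p i)%N]) ->
  undercut_records n M p ->
  bad m None M p /\
  (forall b, (b <= M)%N -> (exists j, [/\ (j < size p)%N & (nth 0 p j < b)%N]) ->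
     bad m (Some b) M p).
Proof.
elim: p n M => [|d p IH] n M hm hu.
  split=> [/=|b _ [j [//]]]; case: hm => [->//|[i []//]].
have hu' M' : (M <= M')%N -> (d <= M')%N -> undercut_records n.-1 M' p.
  move=> MM dM i iN ip iM rec.
  have [||||[|j] [ij jp jd]] := hu i.+1 => //=; [lia|lia| |by exists j].
  by case=> [|j] ji /=; [lia|apply: rec].
have hm' M' : (M <= M')%N -> (d <= M')%N ->
    (m <= M')%N \/ (exists i, [/\ (i < n.-1)%N, (i < size p)%N & (m <= nth 0 p i)%N]).
  move=> MM dM; case: hm => [mM|[[|i] [iN ip im]]]; first by left; lia.
    by left; move: im => /=; lia.
  by right; exists i; split=> //; lia.
split=> [|b bM [j [jp jb]]] /=.
  case: (leqP m M) => //= mM; have n0 : (0 < n)%N.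
    by case: hm => [|[i []]]; lia.
  case: ltnP => dM; last by have [] := IH n.-1 M (hm' _ (leqnn _) dM) (hu' _ (leqnn _) dM).
  have [_ +] := IH n.-1 d (hm' _ (ltnW dM) (leqnn _)) (hu' _ (ltnW dM) (leqnn _)).
  apply=> //; have [||||[|j] [//= ij jp jd]] := hu 0%N => //.
  by exists j.
case: ltnP => db.
  by have [] := IH n.-1 M (hm' _ (leqnn _) _) (hu' _ (leqnn _) _); lia.
have [_ +] := IH n.-1 (maxn M d) (hm' _ (leq_maxl _ _) (leq_maxr _ _))
  (hu' _ (leq_maxl _ _) (leq_maxr _ _)).
apply; first by lia.
by case: j jp jb => [/=|j]; [lia|exists j].
Qed.

Lemma sum_count m (p : seq nat) : (forall d, d \in p -> (d < m)%N) ->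
  (\sum_(l < m) count (pred1 (l : nat)) p = size p)%N.
Proof.
elim: p => [|d p IH] h /=; first by rewrite big1.
rewrite big_split /= IH; last by move=> e ep; apply: h; rewrite inE ep orbT.
have dm : (d < m)%N by apply: h; rewrite inE eqxx.
rewrite (bigD1 (Ordinal dm)) //= eqxx big1 ?addn0 // => i /eqP id.
by rewrite eq_sym; case: eqP => // e; case: id; apply: val_inj.
Qed.

Lemma pigeonhole_levels m q (p : seq nat) : (m * q < size p)%N ->
  (forall d, d \in p -> (d < m)%N) -> exists2 l, (l < m)%N & visits l q.+1 p.
Proof.
move=> hs h; case: (pselect (exists2 l, (l < m)%N & visits l q.+1 p)) => // no.
suff : (size p <= m * q)%N by rewrite leqNgt hs.
rewrite -(sum_count h) -[X in (_ <= X * q)%N]card_ord -sum_nat_const; apply: leq_sum => l _.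
rewrite leqNgt; apply/negP => hl; apply: no; exists (l : nat) => //.
Qed.

(** If level [m] is reached in the first [n] entries, the path is bad; otherwise these entries share
    [m] levels, and one level occurs more than [q] times. *)
Lemma undercut_dichotomy m q n M p : (m * q < n)%N -> (n <= size p)%N ->
  undercut_records n M p ->
  bad m None M p || has (fun l => visits l q.+1 p) (iota 0 m).
Proof.
move=> mqn nt hu.
case: (boolP (has (fun d => m <= d)%N (take n p))) => [/hasP[d dp md]|].
  apply/orP; left; apply: (proj1 (bad_undercut _ hu)).
  right; exists (index d (take n p)); move: (dp); rewrite -index_mem size_takel // => ip.
  split=> //; first exact: leq_trans ip nt.
  by rewrite -(nth_take 0 ip) nth_index.
move/hasPn => h; apply/orP; right.
have [||l lm lv] := @pigeonhole_levels m q (take n p).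
- by rewrite size_takel.
- by move=> d dp; have := h d dp; rewrite /= -ltnNge.
apply/hasP; exists l; first by rewrite mem_iota.
apply: leq_trans lv _; rewrite -{2}(cat_take_drop n p) count_cat leq_addr //.
Qed.

(** * Stretched exponential bounds *)

Section Numeric.
Context {R : realType}.

Lemma small_excess (rho : R) : 0 <= rho -> rho < 1 ->
  exists y, [/\ 1 < y, y * rho < 1 &
    rho + (y - 1) * rho ^+ 2 / (1 - y * rho) <= y^-1].
Proof.
(* With this [y], [1 - y * rho >= e / 2], so the fraction is at most [e / 2], and
   [1 - e / 2 <= y^-1]. *)
move=> r0 r1; pose e := 1 - rho; exists (1 + e ^+ 2 / 4).
have e0 : 0 < e by rewrite /e; lra.
have e1 : e <= 1 by rewrite /e; lra.
have -> : rho = 1 - e by rewrite /e; lra.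
clearbody e; clear r0 r1 rho.
have e2 : 0 < e ^+ 2 by rewrite exprn_gt0.
have e2e : e ^+ 2 <= e by rewrite expr2 ler_piMl // ltW.
have h : e / 2 <= 1 - (1 + e ^+ 2 / 4) * (1 - e) by nra.
split; [lra|lra|].
apply: (@le_trans _ _ (1 - e / 2)).
  have : (1 + e ^+ 2 / 4 - 1) * (1 - e) ^+ 2 / (1 - (1 + e ^+ 2 / 4) * (1 - e)) <= e / 2.
    rewrite ler_pdivrMr; last by lra.
    have : (1 - e) ^+ 2 <= 1 by nra.
    by nra.
  lra.
have e3 : 0 <= e * e ^+ 2 by rewrite mulr_ge0 // ltW.
by rewrite -[leRHS]mul1r ler_pdivlMr; lra.
Qed.

(** Each of the first [s] terms of the geometric series is at least [z ^+ s]. *)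
Lemma mul_expr_le (z : R) s : 0 <= z -> z < 1 -> s%:R * z ^+ s <= (1 - z)^-1.
Proof.
move=> z0 z1; have h : s%:R * z ^+ s * (1 - z) <= 1 - z ^+ s.
  elim: s => [|s IH]; first by rewrite !mul0r expr0 subrr.
  rewrite -natr1 exprS; have : 0 <= z ^+ s by rewrite exprn_ge0.
  have : z ^+ s <= 1 by rewrite exprn_ile1 // ltW.
  move: IH; set a := z ^+ s; set b := s%:R => IH a1 a0.
  have := ler_wpM2l z0 IH.
  have : 0 <= (1 - z) * (1 - z * a).
    by rewrite mulr_ge0 ?subr_ge0 ?(ltW z1) // mulr_ile1 // ltW.
  lra.
rewrite -[leRHS]mul1r ler_pdivlMr ?subr_gt0 //; apply: le_trans h _.
by rewrite gerBl exprn_ge0.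
Qed.

Lemma stretched_bound (y r : R) : 1 < y -> 0 <= r -> r < 1 ->
  exists C C' : R, [/\ 0 < C, 0 < C',
    forall x, 0 <= x -> x < 1 -> 1 <= C * expR (- (C' * x)) &
    forall s x, 0 <= x -> x <= s.+2%:R ->
      y ^+ 2 / y ^+ s + s%:R * r ^+ s <= C * expR (- (C' * x))].
Proof.
(* The rate [w] lies strictly above [r], so that [(r / w) ^+ s] absorbs the factor [s]; dividing by
   [w ^+ 2] in [C] makes up for the shift from [s] to [s + 2]. *)
move=> y1 r0 r1; pose w := Num.max y^-1 ((1 + r) / 2).
have y0 : 0 < y by lra.
have w0 : 0 < w by rewrite lt_max invr_gt0 y0.
have w1 : w < 1 by rewrite gt_max invf_lt1 // y1 /=; lra.
have yw : y^-1 <= w by rewrite le_max lexx.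
have rw : r < w by rewrite lt_max; apply/orP; right; lra.
pose z := r / w.
have z0 : 0 <= z by rewrite divr_ge0 // ltW.
have z1 : z < 1 by rewrite ltr_pdivrMr // mul1r.
pose K := y ^+ 2 + (1 - z)^-1.
have K1 : 1 <= K.
  have : 1 <= y ^+ 2 by rewrite exprn_ege1 // ltW.
  have : 0 <= (1 - z)^-1 by rewrite invr_ge0; lra.
  by rewrite /K; lra.
exists (K / w ^+ 2), (- ln w); have lw : ln w < 0 by rewrite ln_lt0 // w0.
have w2 : 0 < w ^+ 2 by rewrite exprn_gt0.
have wE s : w ^+ s = expR (ln w * s%:R) by rewrite mulrC expRM_natl lnK.
split; [by rewrite divr_gt0 //; lra|by rewrite oppr_gt0| |].
- move=> x x0 x1; rewrite mulNr opprK.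
  apply: (@le_trans _ _ (K / w ^+ 2 * w ^+ 1)); last first.
    rewrite ler_wpM2l ?divr_ge0 ?(ltW w2) //; first by lra.
    by rewrite wE ler_expR ler_wnM2l ?ltW.
  rewrite mulrAC ler_pdivlMr // mul1r expr2 expr1 ler_pM2r //; lra.
move=> s x x0 xs; rewrite mulNr opprK.
apply: (@le_trans _ _ (K / w ^+ 2 * w ^+ s.+2)); last first.
  rewrite ler_wpM2l ?divr_ge0 ?(ltW w2) //; first by lra.
  by rewrite wE ler_expR ler_wnM2l // ltW.
have -> : K / w ^+ 2 * w ^+ s.+2 = K * w ^+ s.
  by rewrite (exprD w 2 s) mulrA divfK // gt_eqF.
rewrite /K mulrDl lerD //.
  rewrite ler_wpM2l ?exprn_ge0 ?(ltW y0) // -exprVn; apply: lerXn2r => //.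
    by rewrite nnegrE invr_ge0 ltW.
  by rewrite nnegrE ltW.
have -> : r ^+ s = z ^+ s * w ^+ s by rewrite -exprMn divfK // gt_eqF.
by rewrite mulrA ler_wpM2r ?exprn_ge0 ?(ltW w0) // mul_expr_le.
Qed.

End Numeric.

(** * Realizations of the process *)

Section Discrete.
Context {d : measure_display} {Omega : measurableType d}.

(** Measurability for the full power set of the target, which suits trees and histories, as they
    range over countable types. *)
Definition discrete {C : Type} (g : Omega -> C) := forall A : set C, measurable (g @^-1` A).

Lemma discrete_points (C : countType) (g : Omega -> C) :
  (forall c, measurable (g @^-1` [set c])) -> discrete g.
Proof.
move=> h A; have -> : g @^-1` A = \bigcup_c (if c \in A then g @^-1` [set c] else set0).
  apply/seteqP; split=> [w /= Aw|w [c _]].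
    by exists (g w) => //; rewrite mem_set.
  by case: ifP => // /set_mem Ac /= ->.
apply: countable_bigcupT_measurable; first exact: countableP.
by move=> c; case: ifP.
Qed.

Lemma discrete_comp (C D : Type) (g : Omega -> C) (h : C -> D) :
  discrete g -> discrete (h \o g).
Proof. by move=> dg A; exact: (dg (h @^-1` A)). Qed.

Lemma discrete_cst (C : Type) (c : C) : discrete (cst c).
Proof. by move=> A; rewrite preimage_cst; case: ifP. Qed.

Lemma discrete_pair (C D : countType) (g : Omega -> C) (h : Omega -> D) :
  discrete g -> discrete h -> discrete (fun w => (g w, h w)).
Proof.
move=> dg dh; apply: discrete_points => -[c e].
rewrite (_ : _ @^-1` _ = g @^-1` [set c] `&` h @^-1` [set e]).
  exact: measurableI.
by apply/seteqP; split=> w /= [-> ->].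
Qed.

End Discrete.

Section Process.
Context {d : measure_display} {Omega : measurableType d} {R : realType}.
Variables (P : probability Omega R) (Q : probability nat R).
Variables (xi : nat -> {RV P >-> nat}) (T : nat -> Omega -> tree) (X : nat -> {RV P >-> nat}).
Hypothesis proc : is_QTBRW Q xi T X.

Local Notation hist n := (past T (fun i => X i) n).
Local Notation state n w := (T n w, X n w).

Definition future n j w := [seq level (state i w) | i <- iota n.+1 j].

Lemma pastS n w : hist n.+1 w = rcons (hist n w) (state n.+1 w).
Proof. by rewrite /past -addn1 iotaD map_cat /= cats1. Qed.

Lemma past_last n w s0 : last s0 (hist n w) = state n w.
Proof. by case: n => // n; rewrite pastS last_rcons. Qed.

Lemma futureS n j w : future n j.+1 w = level (state n.+1 w) :: future n.+1 j w.
Proof. by []. Qed.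

Lemma discrete_RV (Y : {RV P >-> nat}) : discrete Y.
Proof. by move=> A; rewrite -(setTI (_ @^-1` _)); apply: (measurable_funP Y). Qed.

Lemma discrete_tree n : discrete (T n).
Proof.
elim: n => [|n IH].
  have -> : T 0%N = cst single_edge by apply/funext => w; exact: (tbrw_T0 proc).
  exact: discrete_cst.
rewrite (_ : T n.+1 = (fun p => attach p.1.1 p.1.2 p.2) \o
   (fun w => ((T n w, X n w), xi n.+1 w))).
  apply: discrete_comp; apply: discrete_pair; last exact: discrete_RV.
  by apply: discrete_pair => //; exact: discrete_RV.
by apply/funext => w /=; rewrite (tbrw_grow proc).
Qed.

Lemma discrete_state n : discrete (fun w => state n w).
Proof. by apply: discrete_pair; [exact: discrete_tree|exact: discrete_RV]. Qed.

Lemma discrete_past n : discrete (hist n).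
Proof.
elim: n => [|n IH].
  rewrite (_ : hist 0 = (fun s => [:: s]) \o (fun w => state 0%N w)) //.
  exact/discrete_comp/discrete_state.
rewrite (_ : hist n.+1 = (fun p => rcons p.1 p.2) \o (fun w => (hist n w, state n.+1 w))).
  by apply: discrete_comp; apply: discrete_pair => //; exact: discrete_state.
by apply/funext => w; rewrite pastS.
Qed.

Lemma discrete_future n j : discrete (future n j).
Proof.
elim: j n => [|j IH] n; first exact: discrete_cst.
rewrite (_ : future n j.+1 = (fun p => p.1 :: p.2) \o
   (fun w => (level (state n.+1 w), future n.+1 j w))) //.
apply: discrete_comp; apply: discrete_pair => //.
exact/discrete_comp/discrete_state.
Qed.

Local Open Scope ereal_scope.

Lemma law_point n i : P (xi n.+1 @^-1` [set i]) = Q [set i].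
Proof. by rewrite -(tbrw_law proc n). Qed.

(** Given the history, the next tree and the number of new leaves determine each other through the
    size of the tree; this combines [tbrw_indep] with [tbrw_move]. *)
Lemma move_prob n h T0 v i y : last (T0, v) h = (T0, v) -> h <> [::] ->
  P (hist n @^-1` [set h] `&` (xi n.+1 @^-1` [set i]) `&` (X n.+1 @^-1` [set y])) =
  P (hist n @^-1` [set h]) * Q [set i] *
  ((y \in neighbors (attach T0 v i) v)%:R / (deg (attach T0 v i) v)%:R)%:E.
Proof.
move=> hl h0; set T' := attach T0 v i.
have E : hist n @^-1` [set h] `&` (xi n.+1 @^-1` [set i]) =
    [set w | [/\ hist n w = h, X n w = v & T n.+1 w = T']].
  apply/seteqP; split=> w /= [].
    move=> hh xw; have := past_last n w (T0, v); rewrite hh hl => -[Te Xe].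
    by split=> //; rewrite (tbrw_grow proc) -Te -Xe xw.
  move=> hh Xe Te; split=> //; have := past_last n w (T0, v); rewrite hh hl => -[Te' _].
  move: Te; rewrite (tbrw_grow proc) -Te' Xe => /(congr1 size).
  by rewrite !size_attach => /addnI.
have := tbrw_move proc n h T' v y; rewrite /= -E.
rewrite (_ : [set w | X n.+1 w = y] = X n.+1 @^-1` [set y]) // => ->.
by rewrite (tbrw_indep proc n [set h] [set i]) law_point.
Qed.

Lemma integral_nat (f : nat -> \bar R) : (forall i, 0 <= f i) ->
  \int[Q]_i f i = \sum_(i <oo) f i * Q [set i].
Proof.
move=> f0; have -> : [set: nat] = \bigcup_i [set i] by apply/seteqP; split=> // i _; exists i.
rewrite ge0_integral_bigcup //.
- apply: eq_eseriesr => i _.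
  rewrite -(integral_cst Q (D := [set i]) _ (f i)) //.
  by apply: eq_integral => j; rewrite inE /= => ->.
- by apply/trivIsetP => i j _ _ /eqP ij; apply/seteqP; split=> // k [/= -> /ij].
Qed.

Lemma finite_series (T0 : tree) v (c : nat -> \bar R) : (forall y, 0 <= c y) ->
  (forall y, y \notin neighbors T0 v -> c y = 0) ->
  \sum_(y <oo) c y = \sum_(y <- neighbors T0 v) c y.
Proof.
move=> c0 cz; rewrite (nneseries_split 0 (size T0).+1) // add0n [X in _ + X]eseries0; last first.
  move=> y yT _; apply: cz; apply/negP => /neighbors_le; lia.
rewrite adde0 /neighbors /vertices big_filter /index_iota subn0.
rewrite [RHS]big_mkcond big_seq [RHS]big_seq; apply: eq_bigr => y yT; case: ifP => // yn.
by apply: cz; rewrite mem_filter yn.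
Qed.

(** Only an upper bound is claimed, so the event may be split over the leaf count and the next
    position by subadditivity; moves to non-neighbors have probability zero. *)
Lemma past_future n j h s (b : pred (seq nat)) : h <> [::] -> last s h = s -> valid s ->
  P (hist n @^-1` [set h] `&` [set w | b (future n j w)]) <=
  P (hist n @^-1` [set h]) * chance Q j s b.
Proof.
elim: j n h s b => [|j IH] n h [T0 v] b h0 hl vs.
  rewrite /chance /=; case e: (b [::]).
    rewrite mule1 (_ : [set w | _] = setT) ?setIT //.
    by apply/seteqP; split=> // w _ /=; rewrite /future /= e.
  rewrite mule0 (_ : [set w | _] = set0) ?setI0 ?measure0 //.
  by apply/seteqP; split=> // w /=; rewrite /future /= e.
set A := hist n @^-1` [set h]; set B := [set w | _].
have mA : measurable A by exact: discrete_past.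
have mB : measurable B by exact: (@discrete_future n j.+1 [set p | b p]).
have mxi i : measurable (xi n.+1 @^-1` [set i]) by exact: discrete_RV.
have mX y : measurable (X n.+1 @^-1` [set y]) by exact: discrete_RV.
have mAB : measurable (A `&` B) by exact: measurableI.
pose f s' := chance Q j s' (fun p => b (level s' :: p)).
have f0 s' : 0 <= f s' by exact: chance_ge0.
have step i y : P (A `&` B `&` (xi n.+1 @^-1` [set i]) `&` (X n.+1 @^-1` [set y])) <=
    P A * Q [set i] * ((y \in neighbors (attach T0 v i) v)%:R / (deg (attach T0 v i) v)%:R)%:E
     * f (attach T0 v i, y).
  rewrite -move_prob // -/A; set E := A `&` (xi n.+1 @^-1` [set i]) `&` (X n.+1 @^-1` [set y]).
  have mE : measurable E by apply: measurableI => //; apply: measurableI.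
  have [yn|yn] := boolP (y \in neighbors (attach T0 v i) v); last first.
    have E0 : P E = 0 by rewrite /E (move_prob _ _ _ hl h0) (negbTE yn) mul0r mule0.
    rewrite E0 mul0e -E0; apply: le_measure; rewrite ?inE //.
      by do 2 apply: measurableI => //.
    by move=> w [[[? _] ?] ?].
  have vs' := valid_move vs yn; set s' := (attach T0 v i, y) in vs' *.
  have h0' : rcons h s' <> [::] by case: (h).
  have := IH n.+1 (rcons h s') s' (fun p => b (level s' :: p)) h0' (last_rcons _ _ _) vs'.
  have EE w : E w -> state n.+1 w = s'.
    move=> [[/= hh xw] /= Xw]; have := past_last n w (T0, v); rewrite hh hl => -[Te Xe].
    by rewrite /s' (tbrw_grow proc) -Te -Xe xw Xw.
  have -> : hist n.+1 @^-1` [set rcons h s'] = E.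
    apply/seteqP; split=> w /=; last first.
      by move=> Ew; rewrite pastS (EE _ Ew); case: Ew => -[-> _] _.
    rewrite pastS => /rcons_inj [hh Te Xe]; split=> //; split=> //=.
    have := past_last n w (T0, v); rewrite hh hl => -[Te' Xe'].
    move: Te; rewrite (tbrw_grow proc) -Te' -Xe' => /(congr1 size).
    by rewrite !size_attach => /addnI.
  apply: le_trans; apply: le_measure; rewrite ?inE.
  - by do 2 apply: measurableI => //.
  - apply: measurableI => //; exact: (@discrete_future n.+1 j [set p | b (level s' :: p)]).
  move=> w [[[Aw Bw] xw] Xw]; have Ew : E w by [].
  by split=> //; move: Bw; rewrite /B /= futureS (EE _ Ew).
have step1 i : P (A `&` B `&` (xi n.+1 @^-1` [set i])) <=
    P A * (average f (attach T0 v i) v * Q [set i]).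
  set F := A `&` B `&` _; have mF : measurable F by apply: measurableI.
  apply: (@le_trans _ _ (\sum_(y <oo) P (F `&` (X n.+1 @^-1` [set y])))).
    apply: measure_sigma_subadditive => //; first by move=> y; apply: measurableI.
    by move=> w Fw; exists (X n.+1 w).
  apply: le_trans (lee_nneseries _ (fun y _ => step i y)) _.
    by move=> y _ _; apply: measure_ge0.
  rewrite (finite_series (T0 := attach T0 v i) (v := v)); last 2 first.
  - move=> y; apply: mule_ge0 => //; apply: mule_ge0; first exact: mule_ge0.
    by rewrite lee_fin divr_ge0.
  - by move=> y /negbTE ->; rewrite mul0r mule0 mul0e.
  rewrite /average (_ : \sum_(y <- _) _ = \sum_(y <- neighbors (attach T0 v i) v)
     (P A * Q [set i] * (deg (attach T0 v i) v)%:R^-1%:E) * f (attach T0 v i, y)).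
    rewrite -ge0_sume_distrr //; rewrite le_eqVlt; apply/orP; left; apply/eqP.
    by rewrite -!muleA; congr (_ * _); rewrite muleC [X in X * _]muleC -muleA.
  rewrite big_seq [RHS]big_seq; apply: eq_bigr => y ->.
  by rewrite mul1r.
apply: (@le_trans _ _ (\sum_(i <oo) P (A `&` B `&` (xi n.+1 @^-1` [set i])))).
  apply: measure_sigma_subadditive => //; first by move=> i; apply: measurableI.
  by move=> w ABw; exists (xi n.+1 w).
apply: le_trans (lee_nneseries _ (fun i _ => step1 i)) _.
  by move=> i _ _; apply: measure_ge0.
have fA : P A \is a fin_num by exact: fin_num_measure.
rewrite -(fineK fA) nneseriesZl; last first.
  by move=> i _; rewrite mule_ge0 // average_ge0.
by rewrite -integral_nat // => i; apply: average_ge0.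
Qed.

End Process.

(** * Renewal times *)

Section Process.
Context {d : measure_display} {Omega : measurableType d} {R : realType}.
Variables (P : probability Omega R) (Q : probability nat R).
Variables (xi : nat -> {RV P >-> nat}) (T : nat -> Omega -> tree) (X : nat -> {RV P >-> nat}).
Hypothesis proc : is_QTBRW Q xi T X.

Local Notation hist n := (past T (fun i => X i) n).
Local Notation state n w := (T n w, X n w).
Local Notation D n w := (dist (T n w) (X n w) tree_root).

(** Moves along edges are guaranteed only almost surely, whereas the path arguments below need them
    at every step. *)
Definition legal (w : Omega) : Prop :=
  forall n, X n.+1 w \in neighbors (T n.+1 w) (X n w).

(** An illegal step is one of countably many null events, indexed by history, position, new tree and
    target; [pickle] enumerates them. *)
Lemma illegal_negligible : P.-negligible [set w | ~ legal w].
Proof.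
pose F n (c : seq (tree * nat) * nat * tree * nat) : set Omega :=
  let: (h, v, T', y) := c in if y \in neighbors T' v then set0 else
  [set w | [/\ hist n w = h, X n w = v & T n.+1 w = T']] `&` [set w | X n.+1 w = y].
have F0 n c : P.-negligible (F n c).
  case: c => [[[h v] T'] y]; rewrite /F; case: ifP => yn; first exact: negligible_set0.
  apply/negligibleP; last first.
    by have := tbrw_move proc n h T' v y; rewrite /= yn mul0r mule0.
  apply: measurableI; last exact: (discrete_RV (X n.+1) [set y]).
  rewrite (_ : [set w | _] = hist n @^-1` [set h] `&`
    (X n @^-1` [set v] `&` T n.+1 @^-1` [set T'])).
    apply: measurableI; first exact: (discrete_past proc n [set h]).
    by apply: measurableI; [exact: (discrete_RV (X n) [set v])|
      exact: (discrete_tree proc n.+1 [set T'])].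
  by apply/seteqP; split=> w [/= a []]; split.
have FN n : P.-negligible (\bigcup_i oapp (F n) set0 (unpickle i)).
  apply: negligible_bigcup => i; case: unpickle => [c|] /=; first exact: F0.
  exact: negligible_set0.
apply: negligibleS (negligible_bigcup FN) => w /= /existsNP[n /negP nl].
exists n; first exact: I.
exists (pickle (hist n w, (X n w : nat), T n.+1 w, (X n.+1 w : nat))); first exact: I.
by rewrite pickleK [oapp _ _ _]/= (negbTE nl).
Qed.

Lemma legal_valid w n : legal w -> valid (state n w).
Proof.
move=> lw; elim: n => [|n IH].
  by rewrite (tbrw_T0 proc) (tbrw_X0 proc); split=> //; exact: grown_single.
have := lw n; rewrite (tbrw_grow proc); exact: valid_move.
Qed.

Lemma legal_dist w n : legal w -> D n w = level (state n w).
Proof. by move=> lw; have [gT XT] := legal_valid n lw; rewrite dist_depth. Qed.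

Lemma legal_depth w s n u : legal w -> (s <= n)%N -> (u <= size (T s w))%N ->
  (u <= size (T n w))%N /\ depth (T n w) u = depth (T s w) u.
Proof.
move=> lw; elim: n => [|n IH]; first by rewrite leqn0 => /eqP ->.
rewrite leq_eqVlt => /predU1P[->//|]; rewrite ltnS => sn us.
have [un dn] := IH sn us; have [gT XT] := legal_valid n lw.
by rewrite (tbrw_grow proc) size_attach depth_attach //; split=> //; lia.
Qed.

Lemma children_visited w n u : children (T n w) u <> [::] ->
  u = 0%N \/ exists2 s, (s < n)%N & X s w = u.
Proof.
elim: n => [|n IH]; first by rewrite (tbrw_T0 proc) /children /=; case: u; [left|].
rewrite (tbrw_grow proc) children_attach; case: eqP => [-> _|_].
  by right; exists n.
rewrite cats0 => /IH[->|[s sn <-]]; [by left|right].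
by exists s => //; apply: ltnW.
Qed.

(** The depth of a vertex never changes, so at a strict record the walk is at a vertex not visited
    before. Only visits create children, hence the parent is its sole neighbor. *)
Lemma record_leaf w n : legal w -> (0 < n)%N ->
  (forall s, (s < n)%N -> (D s w < D n w)%N) -> deg (T n w) (X n w) = 1%N.
Proof.
move=> lw n0 rec; have [gT XT] := legal_valid n lw; rewrite /= in gT XT.
have X0 : X n w != 0%N.
  apply/eqP => e; have := rec _ n0; rewrite [X in (_ < X)%N]legal_dist //.
  by rewrite /level /= e depth0.
rewrite deg_children // X0; case: (children (T n w) (X n w) =P [::]) => [->//|].
move=> /children_visited[e|[s sn e]]; first by rewrite e in X0.
have := rec _ sn; have [_ Xs] := legal_valid s lw; rewrite !legal_dist // /level /=.
rewrite /= in Xs e *; have [_ <-] := legal_depth lw (ltnW sn) Xs.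
by rewrite e ltnn.
Qed.

Lemma future_nth j i w : legal w -> (i < j)%N -> nth 0%N (future T X 0 j w) i = D i.+1 w.
Proof.
move=> lw ij; rewrite (nth_map 0%N) ?size_iota // nth_iota // legal_dist //.
Qed.

Lemma eventually_all n (p : nat -> nat -> Prop) :
  (forall i, (i < n)%N -> exists N, forall N', (N <= N')%N -> p i N') ->
  exists N, forall i N', (i < n)%N -> (N <= N')%N -> p i N'.
Proof.
elim: n => [|n IH] h; first by exists 0%N.
have [|N1 h1] := IH; first by move=> i ii; apply: h; apply: ltnW.
have [N2 h2] := h n (ltnSn n).
exists (maxn N1 N2) => i N'; rewrite ltnS geq_max leq_eqVlt => /predU1P[->|ii] /andP[? ?].
  exact: h2.
exact: h1.
Qed.

(** A record that is not a renewal is undercut at some finite time; a horizon beyond these finitely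
    many times works. The bound 1 is the initial level, and entry [i] of the path belongs to time
    [i + 1]. *)
Lemma no_renewal_undercut w n : legal w ->
  (forall i, (i <= n)%N -> ~ is_renewal T (fun i => X i) w i) ->
  exists N, forall N', (N <= N')%N -> undercut_records n 1 (future T X 0 N' w).
Proof.
move=> lw nr; pose p i N' := (i < N')%N -> (1 < nth 0%N (future T X 0 N' w) i)%N ->
    (forall j, (j < i)%N -> (nth 0 (future T X 0 N' w) j < nth 0 (future T X 0 N' w) i)%N) ->
  exists j, [/\ (i < j)%N, (j < N')%N &
    (nth 0 (future T X 0 N' w) j < nth 0 (future T X 0 N' w) i)%N].
have [N hN] : exists N, forall i N', (i < n)%N -> (N <= N')%N -> p i N'.
  apply: eventually_all => i ii.
  case: (pselect (exists2 t, (i.+1 < t)%N & (D t w < D i.+1 w)%N)) => [[t it Dt]|no].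
    exists t => N' tN iN _ _; exists t.-1.
    by rewrite !future_nth // ?prednK //; [split=> //; lia|lia..].
  exists 0%N => N' _ iN; rewrite future_nth // => h1 hrec; exfalso.
  apply: (nr i.+1 ii); have rec s : (s < i.+1)%N -> (D s w < D i.+1 w)%N.
    case: s => [_|s si]; last by have := hrec s si; rewrite future_nth //; lia.
    by rewrite (tbrw_T0 proc) (tbrw_X0 proc).
  split=> //; first exact: record_leaf.
  by move=> t it; rewrite leqNgt; apply/negP => Dt; apply: no; exists t.
exists N => N' NN i ii; have := hN i N' ii NN; rewrite /p.
by rewrite size_map size_iota.
Qed.

Lemma tau1_gtE (t : R) : [set w | (t%:E < tau1 T (fun i => X i) w)%E] =
  \bigcap_n [set w | is_renewal T (fun i => X i) w n -> t < n%:R].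
Proof.
apply/seteqP; split=> w /= h.
  move=> n _ /= rn; rewrite -lte_fin; apply: lt_le_trans h _.
  by apply: ereal_inf_lbound; exists n.
case: (pselect (exists n, is_renewal T (fun i => X i) w n)) => [[n0 rn0]|no].
  have ex : exists n, `[< is_renewal T (fun i => X i) w n >] by exists n0; apply/asboolP.
  case: (ex_minnP ex) => n /asboolP rn nmin.
  apply: (@lt_le_trans _ _ (n%:R)%:E); first by rewrite lte_fin; apply: (h n).
  apply: le_ereal_inf_tmp => _ [m rm <-]; rewrite lee_fin ler_nat.
  by apply: nmin; apply/asboolP.
rewrite /tau1 (_ : [set _ | _ in _] = set0) ?ereal_inf0 ?ltry //.
by apply/seteqP; split=> // x [n rn _]; case: no; exists n.
Qed.

Lemma measurable_tau1_gt (t : R) :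
  measurable [set w | (t%:E < tau1 T (fun i => X i) w)%E].
Proof.
rewrite tau1_gtE; apply: bigcapT_measurable => n.
have [tn|nt] := ltP t n%:R.
  by rewrite (_ : [set w | _] = setT) //; apply/seteqP; split.
rewrite (_ : [set w | _] = ~` [set w | is_renewal T (fun i => X i) w n]); last first.
  by apply/seteqP; split=> w /= h rn; have := h rn; rewrite ?ltNge ?nt.
apply: measurableC; pose dst (s : tree * nat) := dist s.1 s.2 tree_root.
have mD i j (r : rel nat) : measurable [set w | r (dst (state i w)) (dst (state j w))].
  have := discrete_pair (discrete_state proc i) (discrete_state proc j).
  by move=> /(_ [set s | r (dst s.1) (dst s.2)]).
rewrite (_ : [set w | _] = [set w | (0 < n)%N /\ deg (T n w) (X n w) = 1%N] `&`
   (\bigcap_s [set w | (s < n)%N ==> (dst (state s w) < dst (state n w))%N] `&`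
    \bigcap_s [set w | (n < s)%N ==> (dst (state n w) <= dst (state s w))%N])).
  apply: measurableI.
    exact: (discrete_state proc n [set s | (0 < n)%N /\ deg s.1 s.2 = 1%N]).
  apply: measurableI; apply: bigcapT_measurable => s.
    exact: (mD s n (fun a b => (s < n)%N ==> (a < b)%N)).
  exact: (mD n s (fun a b => (n < s)%N ==> (a <= b)%N)).
apply/seteqP; split=> w /=.
  by case=> n0 dn h1 h2; split=> //; split=> s _ /=; apply/implyP; [exact: h1|exact: h2].
case=> -[n0 dn] [h1 h2]; split=> // s sn.
  by have := h1 s I; rewrite /= sn.
by have := h2 s I; rewrite /= sn.
Qed.

Lemma start_path N (b : pred (seq nat)) :
  (P [set w | b (future T X 0 N w)] <= chance Q N (single_edge, 1%N) b)%E.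
Proof.
have v0 : valid (single_edge, 1%N) by split=> //; exact: grown_single.
have h := @past_future _ _ _ _ _ _ _ _ proc 0 N [:: (single_edge, 1%N)] _ b.
have := h _ _ erefl v0; rewrite (_ : _ @^-1` _ = setT).
  by rewrite setTI probability_setT mul1e; apply.
by apply/seteqP; split=> // w _; rewrite /= /past /= (tbrw_T0 proc) (tbrw_X0 proc).
Qed.

Lemma measurable_future N (b : pred (seq nat)) : measurable [set w | b (future T X 0 N w)].
Proof. exact: (discrete_future proc 0 N [set p | b p]). Qed.

Lemma tail_le (t B : R) (n m q : nat) : n%:R <= t -> (m * q < n)%N ->
  (forall N, (chance Q N (single_edge, 1%N)
     (fun p => bad m None 1 p || has (fun l => visits l q.+1 p) (iota 0 m)) <= B%:E)%E) ->
  (P [set w | (t%:E < tau1 T (fun i => X i) w)%E] <= B%:E)%E.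
Proof.
move=> nt mqn hB; pose b p := bad m None 1 p || has (fun l => visits l q.+1 p) (iota 0 m).
(* Undercuts may come arbitrarily late, so no fixed horizon serves all paths. The event lies, up to
   a null set, in the increasing union of the [C N], each of probability at most [B]. *)
pose C N := \bigcap_k [set w | b (future T X 0 (N + k) w)].
have mC N : measurable (C N) by apply: bigcapT_measurable => k; exact: measurable_future.
have CB N : (P (C N) <= B%:E)%E.
  apply: le_trans (hB N); apply: le_trans (start_path N b); apply: le_measure.
  - by rewrite inE.
  - by rewrite inE; exact: measurable_future.
  - by move=> w /(_ 0%N I); rewrite /= addn0.
have mU : measurable (\bigcup_N C N) by apply: bigcupT_measurable.
have UB : (P (\bigcup_N C N) <= B%:E)%E.
  have cv : P \o C @ \oo --> P (\bigcup_N C N).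
    apply: nondecreasing_cvg_mu => //; apply/nondecreasing_seqP => N.
    apply/subsetPset => w h k _; have := h k.+1 I.
    by rewrite /= addnS addSn.
  rewrite -(cvg_lim _ cv) //; apply: lime_le; first by apply/cvg_ex; eexists; exact: cv.
  by apply: nearW => N; exact: CB.
have [Z [mZ Z0 hZ]] := illegal_negligible.
apply: le_trans UB; rewrite -(measureU0 mU mZ Z0); apply: le_measure.
- by rewrite inE; exact: measurable_tau1_gt.
- by rewrite inE; apply: measurableU.
move=> w; rewrite tau1_gtE => h; case: (pselect (legal w)) => [lw|nl]; last first.
  by right; apply: hZ.
left; have nr i : (i <= n)%N -> ~ is_renewal T (fun i => X i) w i.
  move=> ii ri; have := h i I ri; rewrite ltNge; move/negP; apply.
  by apply: le_trans nt; rewrite ler_nat.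
have [N hN] := no_renewal_undercut lw nr.
exists (maxn N n) => // k _ /=; apply: (@undercut_dichotomy m q n) => //.
  by rewrite size_map size_iota; lia.
by apply: hN; lia.
Qed.

End Process.

Lemma chance_has {R : realType} (Q : probability nat R) n s (I : Type) (r : seq I)
    (b : I -> pred (seq nat)) (B : R) : valid s -> 0 <= B ->
  (forall i, (chance Q n s (b i) <= B%:E)%E) ->
  (chance Q n s (fun p => has (fun i => b i p) r) <= ((size r)%:R * B)%:E)%E.
Proof.
case: s => T v vs B0 h; elim: r => [|i r IH] /=; first by rewrite chance0 ?mul0r.
apply: le_trans (chance_or _ _ _ _ _) _.
rewrite -natr1 mulrDl mul1r addrC EFinD; exact: leeD.
Qed.

Theorem theorem1 (R : realType) (kappa : R)
    (kappa_gt0 : 0 < kappa) (kappa_le1 : kappa <= 1) :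
  exists C C' : R, [/\ 0 < C, 0 < C' &
    forall t : R, 0 <= t ->
      (ereal_sup (\bigcup_(Q in leaf_laws kappa) renewal_tail Q t)
       <= (C * expR (- (C' * (t `^ (1 / 2)))))%:E)%E].
Proof.
have k01 : 0 < kappa <= 1 by rewrite kappa_gt0.
have [k k0 super] := setup_supercritical k01.
have g0 : 0 <= 1 / 12 :> R by lra.
have g1 : 1 / 12 <= 1 / 3 :> R by lra.
(* The bound of [fall_escape] for [g = 1 / 12]. *)
pose rho := 1 - kappa * (1 / 12) / 2 ^+ k.
have p0 : 0 < kappa * (1 / 12) / 2 ^+ k by rewrite divr_gt0 ?exprn_gt0 //; lra.
have rho1 : rho < 1 by rewrite /rho; lra.
have rho0 : 0 <= rho.
  rewrite subr_ge0 ler_pdivrMr ?exprn_gt0 //.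
  have : 1 <= 2 ^+ k :> R by rewrite exprn_ege1 // ler1n.
  by lra.
have [y [y1 yrho small]] := small_excess rho0 rho1.
pose r := return_bound kappa rho.
have r0 : 0 <= r by apply: return_bound_ge0.
have r1 : r < 1 by rewrite /r /return_bound; nra.
have [C [C' [C0 C'0 hC1 hC]]] := stretched_bound y1 r0 r1.
exists C, C'; split=> // t t0; apply: ge_ereal_sup => _ [Q Qk] [d [Om [P [xi [T [X [proc ->]]]]]]].
rewrite div1r powR12_sqrt //; set x := Num.sqrt t.
have x0 : 0 <= x by exact: sqrtr_ge0.
have mt := measurable_tau1_gt proc t.
have [x1|x1] := ltP x 1.
  by apply: le_trans (probability_le1 P mt) _; rewrite lee_fin; apply: hC1.
have /andP[u1 u2] := truncn_itv x0; set u := Num.truncn x in u1 u2.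
have u0 : (0 < u)%N by rewrite -(@ltr_nat R); rewrite -[_.+1%:R]natr1 in u2; lra.
pose s := u.-1; have us : u = s.+1 by rewrite prednK.
(* The horizon is [u^2 <= t], and the target level and the visit count are both [s = u - 1]; this
   gives the strict [s * s < u * u], and [x <= s + 2]. *)
apply: (@tail_le _ _ _ _ _ _ _ _ proc t _ (u * u) s s).
- rewrite natrM -[leRHS]sqr_sqrtr // expr2; apply: ler_pM => //.
- by rewrite ltn_mul // us.
move=> N; have v0 : valid (single_edge, 1%N) by split=> //; exact: grown_single.
have esc n T' v : valid (T', v) -> (0 < v)%N ->
    (fall Q (depth T' v) n (T', v) <= rho%:E)%E.
  by move=> vs v1; apply: (fall_escape kappa_gt0 kappa_le1 g0 g1 k0 super Qk).
apply: le_trans (chance_or _ _ _ _ _) _.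
apply: (@le_trans _ _ ((y ^+ 2 / y ^+ s)%:E + (s%:R * r ^+ s)%:E)%E); last first.
  by rewrite -EFinD lee_fin; apply: hC => //; rewrite -us ltW.
apply: leeD.
  have [h _] := chance_bad rho0 rho1 esc y1 yrho small s N 1 0%N v0.
  apply: le_trans (h isT) _; rewrite lee_fin ler_pM2r ?invr_gt0 ?exprn_gt0 //; last by lra.
  by rewrite ler_weXn2l ?(ltW y1) // ltnS geq_minl.
have := @chance_has R Q N (single_edge, 1%N) nat (iota 0 s) (fun l => visits l s.+1) (r ^+ s) v0.
rewrite size_iota; apply; first by rewrite exprn_ge0.
by move=> l; apply: chance_visits.
Qed.
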